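(* Let $d_x,d_y,k\ge1$ be fixed integers, $\delta>0$ fixed, and let $(X,Y)\in\mathbb{R}^{d_x}\times\mathbb{R}^{d_y}$ have joint density $f$ satisfying Assumption C (see context). Then, as $N\to\infty$, $$\mathrm{Var}\big[\widehat{I}_{\rm tKSG}(X;Y)\big]=O\left(\frac{(\log\log N)^2(\log N)^{(2k+2)(1+\delta)}}{N}\right),$$ $$\mathrm{Var}\big[\widehat{I}_{\rm tBI-KSG}(X;Y)\big]=O\left(\frac{(\log\log N)^2(\log N)^{(2k+2)(1+\delta)}}{N}\right).$$
   Context: $f_X,f_Y$ are marginal densities, $f_{Y|X},f_{X|Y}$ conditional densities, $H_f,H_{f_X},H_{f_Y}$ Hessian matrices. Assumption C: there exist finite positive constants $C_a,\dots,C_h,C_0$ such that (a) $f\le C_a$ almost everywhere; (b) there is $\gamma>0$ with $\int f|\log f|^{1+\gamma}dx\,dy\le C_b$; (c) $\int f\exp\{-bf\}dx\,dy\le C_ce^{-C_0b}$ for all $b>1$; (d) $f$ is twice continuously differentiable with $\|H_f(x,y)\|_2<C_d$ almost everywhere; (e) $f_{Y|X}(y|x)<C_e$ and $f_{X|Y}(x|y)<C_e$ almost everywhere; (f) $f_X<C_f$ and $f_Y<C_f$ almost everywhere; (g) the set of points violating (d), i.e. $\{(x,y):\|H_f(x,y)\|\ge C_d\}$ (points where $f$ is not twice continuously differentiable included), has $(d_x+d_y-1)$-dimensional Hausdorff measure at most $C_g$; (h) the sets $\{x:\|H_{f_X}(x)\|\ge C_d\}$ and $\{y:\|H_{f_Y}(y)\|\ge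 C_d\}$ (same convention) have $(d_x-1)$- and $(d_y-1)$-dimensional Hausdorff measure at most $C_h$, respectively. Estimators: $(X_1,Y_1),\dots,(X_N,Y_N)$ are i.i.d. with density $f$. For $p\in\{2,\infty\}$, $\rho_{k,i,p}$ is the $\ell_p$ distance in $\mathbb{R}^{d_x+d_y}$ from $(X_i,Y_i)$ to its $k$-th nearest neighbor among the other samples; $n_{x,i,p}=\sum_{j\ne i}\mathbb{I}\{\|X_j-X_i\|_p\le\rho_{k,i,p}\}$ and $n_{y,i,p}=\sum_{j\ne i}\mathbb{I}\{\|Y_j-Y_i\|_p\le\rho_{k,i,p}\}$. $\psi$ is the digamma function, $c_{d,2}=\pi^{d/2}/\Gamma(\frac d2+1)$, and $a_N=\big((\log N)^{1+\delta}/N\big)^{1/(d_x+d_y)}$. Set $\iota_{k,i,\infty}=\psi(k)+\log N-\psi(n_{x,i,\infty}+1)-\psi(n_{y,i,\infty}+1)$ if $\rho_{k,i,\infty}\le a_N$, and $0$ otherwise; $\iota_{k,i,2}=\psi(k)+\log N+\log\big(\frac{c_{d_x,2}c_{d_y,2}}{c_{d_x+d_y,2}}\big)-\log n_{x,i,2}-\log n_{y,i,2}$ if $\rho_{k,i,2}\le a_N$, and $0$ otherwise. Then $\widehat{I}_{\rm tKSG}(X;Y)=\frac1N\sum_{i=1}^N\iota_{k,i,\infty}$ and $\widehat{I}_{\rm tBI-KSG}(X;Y)=\frac1N\sum_{i=1}^N\iota_{k,i,2}$. *)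

(* Defs.v *)
From HB Require Import structures.
From mathcomp Require Import all_boot all_order all_algebra.
From mathcomp Require Import finmap.
From mathcomp Require Import all_classical all_reals all_analysis.

Set Implicit Arguments.
Unset Strict Implicit.
Unset Printing Implicit Defensive.
Import Order.TTheory GRing.Theory Num.Theory.
Import numFieldNormedType.Exports.
Local Open Scope classical_set_scope.
Local Open Scope ring_scope.

Definition rV_display : measure_display.
Proof. exact. Qed.

(* The sigma-algebra on R^n generated by the coordinate maps (it is the Borel
   sigma-algebra), on the model of the library's structure on n.-tuple T. *)
Section measurable_rV.
Context {R : realType} {n : nat}.

Let coord (i : 'I_n) (v : 'rV[R]_n) : R := v ord0 i.

Let rV_set0 : g_sigma_preimage coord set0.
Proof. exact: sigma_algebra0. Qed.

Let rV_setC A : g_sigma_preimage coord A -> g_sigma_preimage coord (~` A).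
Proof. exact: sigma_algebraC. Qed.

Let rV_bigcup (F : (set 'rV[R]_n)^nat) :
  (forall i, g_sigma_preimage coord (F i)) ->
  g_sigma_preimage coord (\bigcup_i (F i)).
Proof. exact: sigma_algebra_bigcup. Qed.

HB.instance Definition _ := @isMeasurable.Build rV_display
  'rV[R]_n (g_sigma_preimage coord) rV_set0 rV_setC rV_bigcup.

Lemma measurable_coord (i : 'I_n) :
  measurable_fun [set: 'rV[R]_n] (fun v : 'rV[R]_n => v ord0 i).
Proof.
move=> _ A mA; rewrite setTI; apply: sub_sigma_algebra => /=.
rewrite -bigcup_seq/=; exists i => /=; first by rewrite mem_index_enum.
by exists A => //; rewrite setTI.
Qed.

Lemma measurable_fun_coordP d (T : measurableType d) (g : T -> 'rV[R]_n) :
  measurable_fun [set: T] g <->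
  forall i, measurable_fun [set: T] (fun t => g t ord0 i).
Proof.
split=> [mg i|mg].
  exact: (measurableT_comp (measurable_coord i) mg).
apply: (@measurability _ _ _ _ _ g
  (\big[setU/set0]_(i < n) preimage_set_system setT (coord i) measurable)) => //.
move=> _ [C + <-]; rewrite -bigcup_seq => -[i _ [B mB <-]].
rewrite !setTI -comp_preimage -[X in measurable X]setTI.
exact: (mg i measurableT B mB).
Qed.

End measurable_rV.

Section leb_step.
Context {R : realType} {n : nat}.

Definition rV_cons (p : R * 'rV[R]_n) : 'rV[R]_n.+1 :=
  row_mx (p.1%:M : 'rV_1) p.2.

Lemma measurable_rV_cons :
  measurable_fun [set: R * 'rV[R]_n] rV_cons.
Proof.
apply/measurable_fun_coordP => i; rewrite /rV_cons.
have [j|j] := fintype.splitP (i : 'I_(1 + n)) => ij.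
- rewrite (_ : (fun _ => _) = fst)//; apply/funext => -[t v] /=.
  have -> : i = lshift n j by exact/val_inj.
  by rewrite [LHS](row_mxEl (t%:M : 'rV_1)) mxE (ord1 j) eqxx.
- rewrite (_ : (fun _ => _) = (fun v : 'rV_n => v ord0 j) \o snd); last first.
    apply/funext => -[t v] /=.
    have -> : i = rshift 1 j by exact/val_inj.
    by rewrite [LHS](row_mxEr (t%:M : 'rV_1)).
  exact: (measurableT_comp (measurable_coord j)).
Qed.

Let uncons (v : 'rV[R]_n.+1) : R * 'rV[R]_n :=
  (v ord0 ord0, rsubmx (v : 'rV_(1 + n))).

Let measurable_uncons : measurable_fun [set: 'rV[R]_n.+1] uncons.
Proof.
apply: measurable_fun_pair; first exact: measurable_coord.
apply/measurable_fun_coordP => i.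
rewrite (_ : (fun _ => _) = (fun v : 'rV[R]_n.+1 => v ord0 (rshift 1 i : 'I_(1 + n)))).
  exact: measurable_coord.
by apply/funext => v; rewrite mxE.
Qed.

Let consK : cancel rV_cons uncons.
Proof.
move=> [t v]; rewrite /uncons /rV_cons/= row_mxKr; congr pair.
have -> : ord0 = lshift n (@ord0 0) :> 'I_(1 + n) by exact/val_inj.
by rewrite [LHS](row_mxEl (t%:M : 'rV_1)) mxE eqxx.
Qed.

Variable mu : {sigma_finite_measure set 'rV[R]_n -> \bar R}.

Let prod := (@lebesgue_measure R \x mu)%E.
Let nu := pushforward prod rV_cons.

Let nu0 : nu set0 = 0%E.
Proof. by rewrite /nu /pushforward preimage_set0; exact: measure0. Qed.

Let nu_ge0 A : (0 <= nu A)%E.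
Proof. by rewrite /nu /pushforward; exact: measure_ge0. Qed.

Let nu_sigma_additive : semi_sigma_additive nu.
Proof.
have mc := measurable_rV_cons.
move=> F mF tF mUF; rewrite /nu /pushforward preimage_bigcup.
apply: measure_semi_sigma_additive.
- by move=> i; rewrite -[X in measurable X]setTI; exact: mc.
- apply/trivIsetP => /= i j _ _ ij; rewrite -preimage_setI.
  by move/trivIsetP : tF => /(_ _ _ _ _ ij) ->//; rewrite preimage_set0.
- by rewrite -preimage_bigcup -[X in measurable X]setTI; exact: mc.
Qed.

HB.instance Definition _ :=
  isMeasure.Build _ _ _ nu nu0 nu_ge0 nu_sigma_additive.

Let nu_sigma_finite : sigma_finite [set: 'rV[R]_n.+1] nu.
Proof.
have /sigma_finiteP[F [FT ndF Ffin]] := sigma_finiteT (@lebesgue_measure R).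
have /sigma_finiteP[G [GT ndG Gfin]] := sigma_finiteT mu.
exists (fun i => uncons @^-1` (F i `*` G i)).
  rewrite -preimage_bigcup -[LHS](preimage_setT uncons); congr (_ @^-1` _).
  rewrite -setXTT FT GT predeqE => -[x y]; split.
    move=> [/= [i _ Fx] [j _ Gy]]; exists (maxn i j) => //; split.
    - by move: x Fx; exact/subsetPset/ndF/leq_maxl.
    - by move: y Gy; exact/subsetPset/ndG/leq_maxr.
  by move=> [i _ []/= ? ?]; split; exists i.
move=> i; have [mF Fi] := Ffin i; have [mG Gi] := Gfin i; split.
  by rewrite -[X in measurable X]setTI; apply: measurable_uncons => //; exact: measurableX.
rewrite /nu /pushforward -comp_preimage (_ : _ \o _ = id).
  have -> : prod (id @^-1` (F i `*` G i)) = (lebesgue_measure (F i) * mu (G i))%E.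
    exact: (@product_measure1E _ _ _ _ R lebesgue_measure mu).
  by rewrite lte_mul_pinfty// ge0_fin_numE.
exact/funext/consK.
Qed.

HB.instance Definition _ := Measure_isSigmaFinite.Build _ _ _ nu nu_sigma_finite.

(* The product of the Lebesgue measure on R and mu, moved to R^(n+1). *)
Definition leb_step : {sigma_finite_measure set 'rV[R]_n.+1 -> \bar R} := nu.

End leb_step.

(* Lebesgue measure on R^n *)
Fixpoint leb (R : realType) (n : nat) :
    {sigma_finite_measure set 'rV[R]_n -> \bar R} :=
  match n with
  | 0 => @dirac _ 'rV[R]_0 0 R
  | n'.+1 => leb_step (leb R n')
  end.

Definition l2norm (R : realType) n (v : 'rV[R]_n) : R :=
  Num.sqrt (\sum_(i < n) v ord0 i ^+ 2).

(* The library norm on matrices is the maximum of the absolute values of the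
   entries. *)
Definition linfnorm (R : realType) n (v : 'rV[R]_n) : R := `|v|.

Definition opnorm2 (R : realType) n (A : 'M[R]_n) : R :=
  sup [set l2norm (v *m A) | v in [set v : 'rV[R]_n | l2norm v <= 1]].

Definition hessian (R : realType) n (g : 'rV[R]_n -> R) (z : 'rV[R]_n) :
    'M[R]_n :=
  \matrix_(i, j) 'D_(delta_mx ord0 i) ('D_(delta_mx ord0 j) g) z.

Definition twice_continuously_differentiable_at (R : realType) n
    (g : 'rV[R]_n -> R) (z : 'rV[R]_n) : Prop :=
  (\forall w \near z, differentiable g w /\
     forall j : 'I_n, differentiable ('D_(delta_mx ord0 j) g) w) /\
  {for z, continuous (hessian g)}.

(* g takes extended real values because it may be a marginal density, which is
   an integral; where it is infinite it has no derivatives. *)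
Definition hessian_lt (R : realType) n (C : R) (g : 'rV[R]_n -> \bar R)
    (z : 'rV[R]_n) : Prop :=
  [/\ \forall w \near z, g w \is a fin_num,
      twice_continuously_differentiable_at (fine \o g) z
    & opnorm2 (hessian (fine \o g) z) < C].

(* Hausdorff measure for the Euclidean distance, without normalizing constant:
   a nonempty set U contributes diam(U)^s to a cover (1 if s = 0), and the
   empty set contributes 0. *)
Section hausdorff_measure.
Context {R : realType} {n : nat}.
Local Open Scope ereal_scope.

Definition diameter (U : set 'rV[R]_n) : \bar R :=
  ereal_sup [set (l2norm (p.1 - p.2)%R)%:E | p in U `*` U].

Definition hausdorff_gauge (s : nat) (U : set 'rV[R]_n) : \bar R :=
  if U == set0 then 0 else diameter U ^+ s.

Definition hausdorff_premeasure (s : nat) (e : R) (A : set 'rV[R]_n) : \bar R :=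
  ereal_inf [set \sum_(i <oo) hausdorff_gauge s (U i) |
    U in [set U : (set 'rV[R]_n)^nat |
      A `<=` \bigcup_i U i /\ forall i, diameter (U i) <= e%:E]].

Definition hausdorff_measure (s : nat) (A : set 'rV[R]_n) : \bar R :=
  ereal_sup [set hausdorff_premeasure s e A | e in [set e : R | (0 < e)%R]].

End hausdorff_measure.

(* A point (x, y) of R^dx x R^dy is the vector row_mx x y of R^(dx + dy), with
   coordinates x = lsubmx z and y = rsubmx z. *)
Section densities.
Context {R : realType} {dx dy : nat}.
Variable f : 'rV[R]_(dx + dy) -> R.

Definition marginalX (x : 'rV[R]_dx) : \bar R :=
  (\int[leb R dy]_y (f (row_mx x y))%:E)%E.

Definition marginalY (y : 'rV[R]_dy) : \bar R :=
  (\int[leb R dx]_x (f (row_mx x y))%:E)%E.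

(* Division by 0 gives 0, so the conditional densities vanish where the
   conditioning marginal does (or is infinite). *)
Definition condYX (z : 'rV[R]_(dx + dy)) : R :=
  f z / fine (marginalX (lsubmx z)).

Definition condXY (z : 'rV[R]_(dx + dy)) : R :=
  f z / fine (marginalY (rsubmx z)).

Definition assumptionC : Prop :=
  exists Ca Cb Cc Cd Ce Cf Cg Ch C0 : R,
  [/\ [/\ 0 < Ca, 0 < Cb, 0 < Cc, 0 < Cd & 0 < Ce] /\
      [/\ 0 < Cf, 0 < Cg, 0 < Ch & 0 < C0],
      {ae leb R (dx + dy), forall z, f z <= Ca},
      exists2 gamma : R, 0 < gamma &
        (\int[leb R (dx + dy)]_z (f z * `|ln (f z)| `^ (1 + gamma))%:E
           <= Cb%:E)%E,
      forall b : R, 1 < b ->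
        (\int[leb R (dx + dy)]_z (f z * expR (- b * f z))%:E
           <= (Cc * expR (- C0 * b))%:E)%E
    & [/\ {ae leb R (dx + dy), forall z, hessian_lt Cd (EFin \o f) z},
          {ae leb R (dx + dy), forall z, condYX z < Ce} /\
          {ae leb R (dx + dy), forall z, condXY z < Ce},
          {ae leb R dx, forall x, (marginalX x < Cf%:E)%E} /\
          {ae leb R dy, forall y, (marginalY y < Cf%:E)%E},
          (hausdorff_measure (dx + dy).-1
             (~` [set z | hessian_lt Cd (EFin \o f) z]) <= Cg%:E)%E
        & (hausdorff_measure dx.-1
             (~` [set x | hessian_lt Cd marginalX x]) <= Ch%:E)%E /\
          (hausdorff_measure dy.-1
             (~` [set y | hessian_lt Cd marginalY y]) <= Ch%:E)%E]].

End densities.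

Section random_samples.
Context {R : realType} {d d' : measure_display} {T : measurableType d}
  {T' : measurableType d'}.
Variable P : probability T R.
Local Open Scope ereal_scope.

Definition mutually_independent (Z : nat -> T -> T') : Prop :=
  forall (J : {fset nat}) (A : nat -> set T'),
    (forall j, measurable (A j)) ->
    P (\bigcap_(j in [set` J]) (Z j @^-1` A j)) =
    \big[*%E/1]_(j <- J) P (Z j @^-1` A j).

Definition has_density (mu : set T' -> \bar R) (Z : T -> T') (g : T' -> R) :
    Prop :=
  [/\ measurable_fun [set: T'] g, forall z, (0 <= g z)%R
    & forall A, measurable A -> P (Z @^-1` A) = \int[mu]_(z in A) (g z)%:E].

End random_samples.

Section special_functions.
Context {R : realType}.

Definition Gamma (s : R) : R :=
  \int[lebesgue_measure]_(t in `]0, +oo[) (t `^ (s - 1) * expR (- t)).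

Definition digamma (s : R) : R := derive1 Gamma s / Gamma s.

(* volume of the Euclidean unit ball of R^n *)
Definition ball_volume2 (n : nat) : R :=
  pi `^ (n%:R / 2) / Gamma (n%:R / 2 + 1).

End special_functions.

Section estimators.
Context {R : realType} {dx dy : nat}.
Variables (k N : nat) (delta : R).
Variables (x : nat -> 'rV[R]_dx) (y : nat -> 'rV[R]_dy).

(* The sample is indexed from 0: its points are (x j, y j) for j < N. The k-th
   nearest neighbor exists when 1 <= k < N; otherwise the default 0 of nth is
   immaterial, as only N going to infinity is considered. *)
Definition knn_dist (norm : forall n, 'rV[R]_n -> R) (i : 'I_N) : R :=
  nth 0 (sort <=%R [seq norm _ (row_mx (x j) (y j) - row_mx (x i) (y i))
                   | j : 'I_N <- enum 'I_N & j != i]) k.-1.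

Definition nb_within (norm : forall n, 'rV[R]_n -> R) n (u : nat -> 'rV[R]_n)
    (r : R) (i : 'I_N) : nat :=
  #|[set j : 'I_N | (j != i) && (norm n (u j - u i) <= r)]%SET|.

Definition trunc_radius : R :=
  ((ln N%:R `^ (1 + delta)) / N%:R) `^ ((dx + dy)%:R^-1).

Definition iota_inf (i : 'I_N) : R :=
  let rho := knn_dist (@linfnorm R) i in
  let nx := nb_within (@linfnorm R) x rho i in
  let ny := nb_within (@linfnorm R) y rho i in
  if rho <= trunc_radius then
    digamma k%:R + ln N%:R - digamma nx.+1%:R - digamma ny.+1%:R
  else 0.

Definition iota_2 (i : 'I_N) : R :=
  let rho := knn_dist (@l2norm R) i in
  let nx := nb_within (@l2norm R) x rho i in
  let ny := nb_within (@l2norm R) y rho i in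
  if rho <= trunc_radius then
    digamma k%:R + ln N%:R
    + ln (ball_volume2 dx * ball_volume2 dy / ball_volume2 (dx + dy))
    - ln nx%:R - ln ny%:R
  else 0.

Definition tKSG : R := N%:R^-1 * \sum_(i < N) iota_inf i.

Definition tBI_KSG : R := N%:R^-1 * \sum_(i < N) iota_2 i.

End estimators.

Definition variance_rate (R : realType) (k : nat) (delta : R) (N : nat) : R :=
  ln (ln N%:R) ^+ 2 * ln N%:R `^ ((2 * k + 2)%:R * (1 + delta)) / N%:R.

(* u = O(v) for an extended real sequence u, which must be eventually finite. *)
Definition ebigO (R : realType) (u : nat -> \bar R) (v : nat -> R) : Prop :=
  (\forall N \near \oo, u N \is a fin_num) /\
  (fun N => fine (u N) : R^o) =O_\oo (v : nat -> R^o).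

(* Main.v *)
(* Changing one of the N sample points changes the sum of the N local terms by
   O(log N), deterministically, and the variance of a function with differences
   bounded by c is at most N c^2 / 2. As c = O(log N / N), this gives O((log N)^2 / N), below the claimed rate.

   For the deterministic bound, split the space around the modified point z_l into
   finitely many cones such that two vectors u, v of the same cone with |u| <= |v|
   satisfy |u - v| <= |v|. Consider the indices i in one cone whose ball B(z_i, r_i)
   contains z_l: every such j closer to z_l than i lies in that ball, so the i of rank
   m from z_l counts at least m neighbors other than l. With r_i the k-th nearest
   neighbor distance, at most k indices per cone can therefore have their distance
   changed, each contributing O(log N). For the others only the neighbor counts in the
   marginal spaces move, by at most one, which changes log n or psi(n + 1) by at most
   1/m, and the sum over the ranks m is harmonic. *)
Require Import Defs.
From HB Require Import structures.
From mathcomp Require Import all_boot all_order all_algebra.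
From mathcomp Require Import perm finmap.
From mathcomp Require Import all_classical all_reals all_analysis.
From mathcomp Require Import measurable_realfun.
From mathcomp Require Import ring lra zify.
Import Order.TTheory GRing.Theory Num.Theory.
Import numFieldNormedType.Exports.
Local Open Scope classical_set_scope.
Local Open Scope ring_scope.

Set Implicit Arguments.
Unset Strict Implicit.
Unset Printing Implicit Defensive.

(** * Variance under bounded differences *)

Definition box (S : Type) n (A : 'I_n -> set S) : set (n.-tuple S) :=
  [set t | forall i, A i (tnth t i)].

Lemma measurable_box d (S : measurableType d) n (A : 'I_n -> set S) :
  (forall i, measurable (A i)) -> measurable (box A).
Proof.
move=> mA; rewrite (_ : box A = \bigcap_(i in [set: 'I_n]) (tnth (T := S) ^~ i @^-1` A i)).
  apply: fin_bigcap_measurable => //= i _.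
  by rewrite -[X in measurable X]setTI; apply: measurable_tnth.
by apply/seteqP; split=> [t tA i _|t tA i]; exact: tA.
Qed.

Lemma box_generate d (S : measurableType d) n :
  @measurable _ (n.-tuple S) =
  <<s [set box A | A in [set A : 'I_n -> set S | forall i, measurable (A i)]] >>.
Proof.
apply/seteqP; split.
  apply: smallest_sub; first exact: smallest_sigma_algebra.
  rewrite -bigcup_seq => B [i /= _ [C mC <-]].
  apply: sub_sigma_algebra => /=.
  exists (fun j => if j == i then C else setT).
    by move=> j; case: ifP.
  rewrite setTI; apply/seteqP; split=> [t /(_ i)|t /= Ct j].
    by rewrite eqxx.
  by case: eqP => [->|].
apply: smallest_sub; first exact: sigma_algebra_measurable.
by move=> _ [A mA <-]; exact: measurable_box.
Qed.

(** Boxes generate the product sigma-algebra and are closed under intersection. The full space is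
    itself a box, so the constant sequence [setT] is the exhausting sequence of finite mass. *)
Lemma tuple_measure_unique d (S : measurableType d) n (R : realType)
    (m1 m2 : {measure set (n.-tuple S) -> \bar R}) :
  (m1 setT < +oo)%E ->
  (forall A : 'I_n -> set S, (forall i, measurable (A i)) -> m1 (box A) = m2 (box A)) ->
  forall E, measurable E -> m1 E = m2 E.
Proof.
move=> m1T m12.
have boxT : box (fun _ : 'I_n => [set: S]) = setT by apply/seteqP.
apply: (measure_unique _ (fun=> setT) (@box_generate _ S n)).
- move=> _ _ [A mA <-] [B mB <-]; exists (fun i => A i `&` B i).
    by move=> i; exact: measurableI.
  apply/seteqP; split=> [t AB|t [tA tB] i]; last by split.
  by split=> i; case: (AB i).
- by move=> _; exists (fun=> setT).
- by rewrite bigcup_const//; exists 0%N.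
- by move=> _ [A mA <-]; exact: m12.
- by [].
Qed.

Lemma bounded_fun_integrable d (T : measurableType d) (R : realType)
    (mu : {measure set T -> \bar R}) (h : T -> R) (B : R) :
  (mu setT < +oo)%E -> measurable_fun setT h -> (forall t, `|h t| <= B) ->
  mu.-integrable setT (EFin \o h).
Proof.
move=> muT mh hB; apply: measurable_bounded_integrable => //.
exists B; split; first exact: num_real.
by move=> M BM t _; rewrite /= (le_trans (hB t))// ltW.
Qed.

Section iid.
Context d d' (T : measurableType d) (S : measurableType d') (R : realType).
Variables (P : probability T R) (Z : nat -> T -> S).
Hypothesis mZ : forall i, measurable_fun [set: T] (Z i).
Hypothesis indepZ : mutually_independent P Z.
Hypothesis idZ : forall i j A, measurable A -> P (Z i @^-1` A) = P (Z j @^-1` A).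

(** The index map is arbitrary so that the single sequence [Z] supplies the original sample, an
    independent copy of it and every hybrid of the two. *)
Definition sample n (s : 'I_n -> nat) (w : T) : n.-tuple S :=
  [tuple Z (s i) w | i < n].

Lemma measurable_sample n (s : 'I_n -> nat) : measurable_fun [set: T] (sample s).
Proof.
apply/measurable_fun_tnthP => i.
rewrite (_ : _ \o _ = Z (s i)); first exact: mZ.
by apply/funext => w /=; rewrite tnth_mktuple.
Qed.

Lemma sample_box n (s : 'I_n -> nat) (A : 'I_n -> set S) :
  injective s -> (forall i, measurable (A i)) ->
  P (sample s @^-1` box A) = (\prod_(i < n) P (Z 0 @^-1` A i))%E.
Proof.
move=> s_inj mA.
pose J := [fset s i | i in 'I_n]%fset.
(* [B] moves the sides of the box from positions to indices of the sequence. Injectivity of [s]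
   makes [B (s i)] equal to [A i], and indices outside the range of [s] are unconstrained. *)
pose B j := if [pick i | s i == j] is Some i then A i else setT.
have BE i : B (s i) = A i.
  rewrite /B; case: pickP => [i' /eqP/s_inj->//|/(_ i)].
  by rewrite eqxx.
have mB j : measurable (B j) by rewrite /B; case: pickP.
transitivity (P (\bigcap_(j in [set` J]) (Z j @^-1` B j))).
  congr (P _); apply/seteqP; split=> [w wA j /= /imfsetP[i _ ->]|w wB i].
    by rewrite /= BE; have := wA i; rewrite tnth_mktuple.
  by rewrite tnth_mktuple -BE; apply: wB => /=; apply/imfsetP; exists i.
rewrite (indepZ _ mB) /J big_imfset/=; last by move=> i j _ _ /s_inj.
rewrite big_enum/=.
by apply: eq_bigr => i _; rewrite BE; exact: idZ.
Qed.
Definition sampleRV n (s : 'I_n -> nat) : {mfun T >-> n.-tuple S} :=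
  MeasurableFun.Pack (MeasurableFun.Class (isMeasurableFun.Build _ _ _ _ _ (measurable_sample s))).

Lemma sample_law n (s s' : 'I_n -> nat) E :
  injective s -> injective s' -> measurable E ->
  P (sample s @^-1` E) = P (sample s' @^-1` E).
Proof.
move=> s_inj s'_inj.
apply: (@tuple_measure_unique _ _ _ _
  (distribution P (sampleRV s)) (distribution P (sampleRV s'))).
  by rewrite (le_lt_trans (probability_le1 _ _))// ltry.
move=> A mA; change (P (sample s @^-1` box A) = P (sample s' @^-1` box A)).
by rewrite !sample_box.
Qed.

Lemma sample_indep_box n (s s' : 'I_n -> nat) (A B : 'I_n -> set S) :
  injective s -> injective s' -> (forall i j, s i != s' j) ->
  (forall i, measurable (A i)) -> (forall i, measurable (B i)) ->
  P (sample s @^-1` box A `&` sample s' @^-1` box B) =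
  (P (sample s @^-1` box A) * P (sample s' @^-1` box B))%E.
Proof.
move=> s_inj s'_inj ss' mA mB.
(* Since the ranges are disjoint, the concatenated index map is injective. The pair of samples is
   then one sample of length [n + n], whose box probability is a product that splits into halves. *)
pose u (i : 'I_(n + n)) := match fintype.split i with inl j => s j | inr j => s' j end.
pose C (i : 'I_(n + n)) := match fintype.split i with inl j => A j | inr j => B j end.
have ul i : u (lshift n i) = s i by rewrite /u (unsplitK (inl i)).
have ur i : u (rshift n i) = s' i by rewrite /u (unsplitK (inr i)).
have Cl i : C (lshift n i) = A i by rewrite /C (unsplitK (inl i)).
have Cr i : C (rshift n i) = B i by rewrite /C (unsplitK (inr i)).
have u_inj : injective u.
  move=> i j; rewrite -(splitK i) -(splitK j).
  case: (fintype.split i) => a; case: (fintype.split j) => b /=; rewrite ?ul ?ur.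
  - by move/s_inj ->.
  - by move/eqP; rewrite (negbTE (ss' _ _)).
  - by move/esym/eqP; rewrite (negbTE (ss' _ _)).
  - by move/s'_inj ->.
have -> : sample s @^-1` box A `&` sample s' @^-1` box B = sample u @^-1` box C.
  apply/seteqP; split=> [w [wA wB] i|w wC].
    rewrite -(splitK i); case: (fintype.split i) => a /=.
      by have := wA a; rewrite !tnth_mktuple ul Cl.
    by have := wB a; rewrite !tnth_mktuple ur Cr.
  split=> i.
    by have := wC (lshift n i); rewrite !tnth_mktuple ul Cl.
  by have := wC (rshift n i); rewrite !tnth_mktuple ur Cr.
rewrite !sample_box//.
  rewrite big_split_ord/=; congr (_ * _)%E; apply: eq_bigr => i _; by rewrite ?Cl ?Cr.
by move=> i; rewrite /C; case: fintype.split.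
Qed.

(** As functions of [E], both sides are finite measures: the push-forward by [sample s] of [P]
    restricted to the event on [s'], and the law of [sample s] scaled by the probability of that
    event. Agreement on boxes extends to all measurable sets. *)
Let indep_step n (s s' : 'I_n -> nat) (F : set (n.-tuple S)) :
  measurable F ->
  (forall A, (forall i, measurable (A i)) ->
    P (sample s @^-1` box A `&` sample s' @^-1` F) =
    (P (sample s @^-1` box A) * P (sample s' @^-1` F))%E) ->
  forall E, measurable E ->
    P (sample s @^-1` E `&` sample s' @^-1` F) =
    (P (sample s @^-1` E) * P (sample s' @^-1` F))%E.
Proof.
move=> mF H E mE.
have mF' : measurable (sample s' @^-1` F).
  by rewrite -[X in measurable X]setTI; exact: measurable_sample.
have Ffin : P (sample s' @^-1` F) \is a fin_num by exact: fin_num_measure.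
pose c := NngNum (fine_ge0 (measure_ge0 P (sample s' @^-1` F))).
pose m0 : {measure set T -> \bar R} := mrestr P mF'.
have uniq := @tuple_measure_unique _ _ _ _
  (measure_function_pushforward__canonical__measure_function_Measure
    m0 (measurable_sample s))
  (mscale c (distribution P (sampleRV s))) _ _ E mE.
have cE : (c%:num%:E = P (sample s' @^-1` F))%E by rewrite /= fineK.
have {}uniq : (P (sample s @^-1` E `&` sample s' @^-1` F) = c%:num%:E * P (sample s @^-1` E))%E.
  apply: uniq.
    change (P (sample s @^-1` setT `&` sample s' @^-1` F) < +oo)%E.
    by rewrite preimage_setT setTI ltey_eq Ffin.
  move=> A mA.
  change (P (sample s @^-1` box A `&` sample s' @^-1` F) =
    c%:num%:E * P (sample s @^-1` box A))%E.
  by rewrite cE H// muleC.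
by rewrite uniq cE muleC.
Qed.

Lemma sample_indep n (s s' : 'I_n -> nat) E F :
  injective s -> injective s' -> (forall i j, s i != s' j) ->
  measurable E -> measurable F ->
  P (sample s @^-1` E `&` sample s' @^-1` F) =
  (P (sample s @^-1` E) * P (sample s' @^-1` F))%E.
Proof.
(* Boxes are replaced by measurable sets one factor at a time: first [E] with [F] fixed, then [F]
   with a box in place of [E]. *)
move=> s_inj s'_inj ss' mE mF; apply: indep_step => // A mA.
rewrite setIC muleC; apply: indep_step => //; first exact: measurable_box.
by move=> B mB; rewrite setIC muleC sample_indep_box.
Qed.

(** Independence identifies the joint law of the two samples with the product of their laws, and
    Fubini factors the integral. *)
Lemma sample_indep_integral n (s s' : 'I_n -> nat) (g : n.-tuple S -> R) B :
  injective s -> injective s' -> (forall i j, s i != s' j) ->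
  measurable_fun setT g -> (forall t, `|g t| <= B) ->
  \int[P]_w (g (sample s w) * g (sample s' w)) =
  \int[P]_w (g (sample s w)) * \int[P]_w (g (sample s' w)).
Proof.
move=> s_inj s'_inj ss' mg gB.
pose m1 := distribution P (sampleRV s).
pose m2 := distribution P (sampleRV s').
pose pr w := (sample s w, sample s' w).
have mpr : measurable_fun setT pr.
  by apply: measurable_fun_pair; exact: measurable_sample.
pose prRV : {mfun T >-> (n.-tuple S * n.-tuple S)%type} :=
  MeasurableFun.Pack (MeasurableFun.Class (isMeasurableFun.Build _ _ _ _ _ mpr)).
pose m' := distribution P prRV.
pose h (t : n.-tuple S * n.-tuple S) := g t.1 * g t.2.
have mh : measurable_fun setT h.
  by apply: measurable_funM; apply: measurableT_comp.
have B0 : 0 <= B by rewrite (le_trans _ (gB (sample s point))).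
have hB t : `|h t| <= B * B by rewrite normrM ler_pM.
have fin_lty (d0 : measure_display) (U : measurableType d0) (mu : probability U R) :
  (mu setT < +oo)%E by rewrite probability_setT ltry.
have ig1 : m1.-integrable setT (EFin \o g).
  exact: (bounded_fun_integrable (fin_lty _ _ _) mg gB).
have ig2 : m2.-integrable setT (EFin \o g).
  exact: (bounded_fun_integrable (fin_lty _ _ _) mg gB).
have m12 X : measurable X -> (m1 \x m2)%E X = m' X.
  apply: product_measure_unique => E F mE mF.
  exact: (sample_indep s_inj s'_inj ss' mE mF).
have ihm' : m'.-integrable setT (EFin \o h).
  exact: (bounded_fun_integrable (fin_lty _ _ _) mh hB).
have ih : (m1 \x m2)%E.-integrable setT (EFin \o h).
  apply: (bounded_fun_integrable _ mh hB).
  exact: (eq_ind_r (fun x => x < +oo)%E (fin_lty _ _ m') (m12 setT measurableT)).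
have icomp (d0 : measure_display) (U : measurableType d0) (X : {mfun T >-> U}) (u : U -> R) C :
    measurable_fun setT u -> (forall t, `|u t| <= C) ->
    (\int[distribution P X]_t (u t)%:E = \int[P]_w (u (X w))%:E)%E.
  move=> mu uC; rewrite integral_distribution//; first exact/measurable_EFinP.
  apply: (bounded_fun_integrable (fin_lty _ _ _) _ (fun t => uC (X t))).
  exact: measurableT_comp.
rewrite /Rintegral -(icomp _ _ prRV h _ mh hB) -(icomp _ _ (sampleRV s) g _ mg gB).
rewrite -(icomp _ _ (sampleRV s') g _ mg gB) -/m' -/m1 -/m2.
have -> : (\int[m']_t (h t)%:E = \int[m1]_x fubini_F m2 (EFin \o h) x)%E.
  rewrite (integral12_prod_meas1 ih).
  apply: (eq_measure_integral (m1 \x m2)%E) => A mA _.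
  exact/esym/m12.
rewrite /fubini_F/=.
under eq_integral.
  move=> x _; rewrite /h/=; under eq_integral do rewrite EFinM.
  rewrite integralZl//; over.
rewrite -fineM; [|exact: integrable_fin_num|exact: integrable_fin_num].
rewrite -(fineK (integrable_fin_num _ ig2))//.
by rewrite integralZr.
Qed.

Lemma sample_law_integral n (s s' : 'I_n -> nat) (h : n.-tuple S -> R) B :
  injective s -> injective s' -> measurable_fun setT h ->
  (forall t, `|h t| <= B) ->
  \int[P]_w h (sample s w) = \int[P]_w h (sample s' w).
Proof.
move=> s_inj s'_inj mh hB.
have icomp (u : 'I_n -> nat) :
    (\int[distribution P (sampleRV u)]_t (h t)%:E = \int[P]_w (h (sample u w))%:E)%E.
  rewrite integral_distribution//; first exact/measurable_EFinP.
  have PT : (P setT < +oo)%E by rewrite probability_setT ltry.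
  apply: (bounded_fun_integrable PT _ (fun t => hB (sampleRV u t))).
  exact: measurableT_comp.
rewrite /Rintegral -!icomp; congr fine.
by apply: eq_measure_integral => A mA _; exact: sample_law.
Qed.

(** Both integrands are the same function [h] of an [m]-tuple, evaluated at the first [m] entries of
    the sequence or at a permutation of them, and these two tuples have the same law. *)
Lemma sample_swap_integral n m (s s' : 'I_n -> 'I_m) (p : 'I_m -> 'I_m)
    (g : n.-tuple S -> R) B :
  injective p -> measurable_fun setT g -> (forall t, `|g t| <= B) ->
  \int[P]_w (g (sample (p \o s) w) * g (sample (p \o s') w)) =
  \int[P]_w (g (sample s w) * g (sample s' w)).
Proof.
move=> p_inj mg gB.
pose pick (u : 'I_n -> 'I_m) (t : m.-tuple S) : n.-tuple S := [tuple tnth t (u i) | i < n].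
have mpick u : measurable_fun setT (pick u).
  apply/measurable_fun_tnthP => i.
  rewrite (_ : _ \o _ = (tnth (T := S))^~ (u i)); first exact: measurable_tnth.
  by apply/funext => w /=; rewrite tnth_mktuple.
have pickE (u : 'I_n -> 'I_m) (v : 'I_m -> nat) w : sample (v \o u) w = pick u (sample v w).
  by apply: eq_from_tnth => i; rewrite !tnth_mktuple.
pose h t := g (pick s t) * g (pick s' t).
have mh : measurable_fun setT h.
  by apply: measurable_funM; apply: measurableT_comp.
have hB t : `|h t| <= B * B by rewrite normrM ler_pM.
transitivity (\int[P]_w h (sample (@nat_of_ord m \o p) w)).
  by apply: eq_Rintegral => w _; rewrite /h -!pickE.
rewrite (sample_law_integral (s' := @nat_of_ord m) _ _ mh hB).
- by apply: eq_Rintegral => w _; rewrite /h -!pickE.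
- by move=> i j /val_inj/p_inj.
- exact: val_inj.
Qed.

(* With an independent copy Z' taken from the same sequence and hyb l the sample whose
   first l entries come from Z', the variance telescopes into the sum over l of
   E[g(Z) (g(hyb l) - g(hyb (l+1)))]. Swapping Z_l with Z'_l preserves the law and
   exchanges the two hybrids, so each term is half of
   E[(g(Z) - g(Z with Z'_l)) (g(hyb l) - g(hyb (l+1)))]. *)
Lemma bounded_difference_variance n (g : n.-tuple S -> R) (B c : R) :
  measurable_fun setT g -> (forall t, `|g t| <= B) ->
  (forall t t' i, (forall j, j != i -> tnth t j = tnth t' j) -> `|g t - g t'| <= c) ->
  ('V_P[fun w => g [tuple Z i w | i < n]] <= (n%:R * c ^+ 2 / 2)%:E)%E.
Proof.
move=> mg gB gc.
pose G (s : 'I_n -> 'I_(n + n)) w := g (sample s w).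
pose E (h : T -> R) := \int[P]_w h w.
have GB s w : `|G s w| <= B by exact: gB.
have mG s : measurable_fun setT (G s).
  by apply: measurableT_comp => //; exact: measurable_sample.
have PT : (P setT < +oo)%E by rewrite probability_setT ltry.
have iG s : P.-integrable setT (EFin \o G s) := bounded_fun_integrable PT (mG s) (GB s).
have GGB s s' w : `|G s w * G s' w| <= B * B by rewrite normrM ler_pM.
have mGG s s' : measurable_fun setT (fun w => G s w * G s' w) by exact: measurable_funM.
have iGG s s' : P.-integrable setT (EFin \o (fun w => G s w * G s' w)).
  exact: bounded_fun_integrable PT (mGG s s') (GGB s s').
pose hyb l (i : 'I_n) := if (i < l)%N then @rshift n n i else @lshift n n i.
have hyb0 : hyb 0%N = @lshift n n by apply/funext => i.
have hybn : hyb n = @rshift n n by apply/funext => i; rewrite /hyb ltn_ord.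
pose mean := E (G (hyb 0%N)).
have step (l : 'I_n) :
    E (fun w => G (hyb 0%N) w * G (hyb l) w) -
    E (fun w => G (hyb 0%N) w * G (hyb l.+1) w) <= c ^+ 2 / 2.
  pose p : 'I_(n + n) -> 'I_(n + n) := tperm (lshift n l) (rshift n l).
  have p_inj : injective p by exact: perm_inj.
  have phl : p \o hyb l = hyb l.+1.
    apply/funext => i; rewrite /p /hyb /= ltnS [(i <= l)%N]leq_eqVlt.
    have [->|il] := eqVneq i l; first by rewrite ltnn eqxx /= tpermL.
    rewrite -val_eqE in il; rewrite (negbTE il)/=.
    case: ifP => _; rewrite tpermD// -val_eqE/=; move: il (ltn_ord i) (ltn_ord l) => /=; lia.
  have phl1 : p \o hyb l.+1 = hyb l.
    by rewrite -phl; apply/funext => i; rewrite /p /= tpermK.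
  have swap u v : E (fun w => G u w * G v w) = E (fun w => G (p \o u) w * G (p \o v) w).
    exact/esym/(sample_swap_integral _ _ p_inj mg gB).
  set x := E _; set y := E _.
  have xE := swap (hyb 0%N) (hyb l); have yE := swap (hyb 0%N) (hyb l.+1).
  rewrite phl -/x in xE; rewrite phl1 -/y in yE.
  (* Only the second copy of [x - y] is rewritten by the swap. The four products then factor into
     two differences, each between samples that disagree only at position [l]. *)
  have : (x - y) + (x - y) <= c ^+ 2.
    rewrite {2}xE {2}yE /x /y /E -!RintegralB//.
    have iB u v u' v' : P.-integrable setT (EFin \o (fun w => G u w * G v w - G u' w * G v' w)).
      apply: (bounded_fun_integrable (B := B * B + B * B) PT).
        exact: measurable_funB.
      by move=> t; rewrite (le_trans (ler_normB _ _))// lerD.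
    rewrite -RintegralD//.
    apply: (@le_trans _ _ (\int[P]_w (c ^+ 2))); last first.
      by rewrite Rintegral_cst// [X in fine X](probability_setT P)/= mulr1.
    apply: le_Rintegral => //.
    + apply: (bounded_fun_integrable (B := (B * B + B * B) + (B * B + B * B)) PT).
        by apply: measurable_funD; exact: measurable_funB.
      move=> t; rewrite (le_trans (ler_normD _ _))// lerD//;
        by rewrite (le_trans (ler_normB _ _))// lerD.
    + by apply: (bounded_fun_integrable (B := `|c ^+ 2|) PT).
    move=> w _.
    have -> : G (hyb 0%N) w * G (hyb l) w - G (hyb 0%N) w * G (hyb l.+1) w +
      (G (p \o hyb 0%N) w * G (hyb l.+1) w - G (p \o hyb 0%N) w * G (hyb l) w) =
      (G (hyb 0%N) w - G (p \o hyb 0%N) w) * (G (hyb l) w - G (hyb l.+1) w) by ring.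
    rewrite (le_trans (ler_norm _))// normrM expr2 ler_pM//.
      apply: (gc _ _ l) => j jl; rewrite !tnth_mktuple hyb0 /p /= tpermD//.
        by rewrite -val_eqE/= eq_sym.
      by rewrite -val_eqE/=; have := ltn_ord j; lia.
    apply: (gc _ _ l) => j jl; rewrite !tnth_mktuple /hyb ltnS [(j <= l)%N]leq_eqVlt.
    by move: jl; rewrite -val_eqE => /negbTE ->.
  by lra.
have meann : E (G (hyb n)) = mean.
  apply: (sample_law_integral _ _ mg gB) => i j.
    by rewrite hybn => /val_inj/rshift_inj.
  by rewrite hyb0 => /val_inj/lshift_inj.
(* The first and last hybrids use disjoint halves of the sequence, so the far end of the telescope
   is the squared mean. *)
have meanE : E (fun w => G (hyb 0%N) w * G (hyb n) w) = mean ^+ 2.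
  rewrite expr2 -{2}meann.
  apply: (sample_indep_integral _ _ _ mg gB) => i j.
  - by rewrite hyb0 => /val_inj/lshift_inj.
  - by rewrite hybn => /val_inj/rshift_inj.
  - by rewrite hyb0 hybn /=; have := ltn_ord i; lia.
have -> : 'V_P[fun w => g [tuple Z i w | i < n]] =
    (E (fun w => G (hyb 0%N) w * G (hyb 0%N) w) - mean ^+ 2)%:E.
  have XE : (fun w => g [tuple Z i w | i < n]) = G (hyb 0%N) by rewrite hyb0.
  rewrite XE /variance covariance.unlock expectation.unlock.
  rewrite -[fine _]/mean.
  have i0 : P.-integrable setT (EFin \o (fun w =>
      G (hyb 0%N) w * G (hyb 0%N) w - mean *+ 2 * G (hyb 0%N) w)).
    apply: (bounded_fun_integrable (B := B * B + `|mean *+ 2| * B) PT).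
      by apply: measurable_funB => //; exact: measurable_funM.
    by move=> w; rewrite (le_trans (ler_normB _ _))// lerD// normrM ler_wpM2l.
  have ic (r : R) : P.-integrable setT (EFin \o (fun=> r)).
    exact: (bounded_fun_integrable (B := `|r|) PT).
  have iZ : P.-integrable setT (EFin \o (fun w => mean *+ 2 * G (hyb 0%N) w)).
    apply: (bounded_fun_integrable (B := `|mean *+ 2| * B) PT).
      exact: measurable_funM.
    by move=> w; rewrite normrM ler_wpM2l.
  transitivity ((\int[P]_w (G (hyb 0%N) w * G (hyb 0%N) w - mean *+ 2 * G (hyb 0%N) w
      + mean ^+ 2))%:E).
    rewrite /Rintegral fineK; last first.
      apply: integrable_fin_num => //.
      exact: (integrableD measurableT i0 (ic (mean ^+ 2))).
    by apply: eq_integral => w _; rewrite -[LHS]/(((G (hyb 0%N) w - mean) * (G (hyb 0%N) w - mean))%:E);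
      congr EFin; ring.
  rewrite RintegralD// RintegralB// RintegralZl// Rintegral_cst//.
  rewrite [X in fine X](probability_setT P)/= mulr1 -/(E _) -/(E _) -/mean; congr EFin; ring.
rewrite lee_fin -meanE.
rewrite -opprB -(@telescope_sumr _ 0%N n (fun l => E (fun w => G (hyb 0%N) w * G (hyb l) w)))//.
rewrite -sumrN big_mkord.
apply: (@le_trans _ _ (\sum_(i < n) (c ^+ 2 / 2))).
  by apply: ler_sum => l _; rewrite opprB.
by rewrite sumr_const card_ord -[leLHS]mulr_natl mulrA.
Qed.
End iid.

(** * Ranks and cones *)

(** Induction removing an element that maximizes [D]: all other elements of [B] are counted for it,
    so its [m] is at least [#|B| - 1] and the last summand on the right pays for it. *)
Lemma rank_sum (I : finType) (R : realDomainType) (B : {set I}) (D : I -> R)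
    (m : I -> nat) (w : nat -> R) :
  {homo w : a b / (a <= b)%N >-> b <= a} ->
  (forall i, i \in B -> (#|[set j in B | (j != i) && (D j <= D i)%R]%SET| <= m i)%N) ->
  \sum_(i in B) w (m i) <= \sum_(j < #|B|) w j.
Proof.
move=> w_anti.
elim: {B}#|B| {-2}B (erefl #|B|) => [|n IH] B Bn mB.
  by rewrite Bn big_ord0 big_pred0// => i; rewrite (cards0_eq Bn) inE.
have /card_gt0P[i0 i0B] : (0 < #|B|)%N by rewrite Bn.
case: (@Order.TotalTheory.arg_maxP _ _ _ i0 (fun i => i \in B) D i0B) => i iB Dmax.
have B'n : #|B :\ i| = n by have := cardsD1 i B; rewrite iB Bn add1n => -[].
rewrite (big_setD1 i iB)/= Bn big_ord_recr/= addrC lerD//.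
  rewrite -B'n; apply: IH => // j; rewrite 2!inE => /andP[ji jB]; apply: leq_trans (mB j jB).
  by apply/subset_leq_card/fintype.subsetP => a; rewrite !inE => /andP[/andP[_ ->]].
apply: w_anti; apply: leq_trans (mB i iB).
rewrite -B'n; apply/subset_leq_card/fintype.subsetP => a; rewrite !inE => /andP[-> aB].
by rewrite aB/=; exact: Dmax.
Qed.

(** [rank_sum] is applied inside each color class, so [m] has to dominate only the rank within the
    class. As [w] is nonnegative, each sum may be lengthened to [#|I|] terms. *)
Lemma colored_rank_sum (I C : finType) (R : realDomainType) (col : I -> C)
    (B : {set I}) (D : I -> R) (m : I -> nat) (w : nat -> R) :
  {homo w : a b / (a <= b)%N >-> b <= a} -> (forall j, 0 <= w j) ->
  (forall i, i \in B ->
    (#|[set j in B | [&& j != i, col j == col i & (D j <= D i)%R]]%SET| <= m i)%N) ->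
  \sum_(i in B) w (m i) <= #|C|%:R * \sum_(j < #|I|) w j.
Proof.
move=> w_anti w0 mB.
rewrite (partition_big col predT)//= mulr_natl -sumr_const.
apply: ler_sum => c _.
pose Bc := [set i in B | col i == c]%SET.
rewrite (eq_bigl (fun i => i \in Bc)); last by move=> i; rewrite !inE.
apply: (@le_trans _ _ (\sum_(j < #|Bc|) w j)).
  apply: (rank_sum (D := D)) => // i; rewrite inE => /andP[iB /eqP ic].
  apply: leq_trans (mB i iB); apply/subset_leq_card/fintype.subsetP => j.
  by rewrite !inE ic => /and3P[/andP[-> ->] -> ->].
rewrite -(big_mkord predT w) -[leRHS](big_mkord predT w).
rewrite (big_cat_nat (n := #|Bc|) (p := #|I|)) ?max_card//=.
by rewrite lerDl sumr_ge0.
Qed.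

(** * Cone colorings for the maximum and Euclidean norms *)

Section norms.
Variable R : realType.

Definition cone_coloring n (nu : 'rV[R]_n -> R) (C : finType) (col : 'rV[R]_n -> C) :=
  forall u v, col u = col v -> nu u <= nu v -> nu (u - v) <= nu v.

Lemma linfnormE n (v : 'rV[R]_n) : linfnorm v = \big[Num.max/0]_ij `|v ij.1 ij.2|.
Proof. by rewrite -mx_normrE. Qed.

Lemma linfnorm_le n (v : 'rV[R]_n) r :
  0 <= r -> (forall i, `|v ord0 i| <= r) -> linfnorm v <= r.
Proof.
by move=> r0 vr; rewrite linfnormE; apply: bigmax_le => // -[i j] _; rewrite ord1.
Qed.

Lemma coord_le_linfnorm n (v : 'rV[R]_n) i : `|v ord0 i| <= linfnorm v.
Proof. by rewrite linfnormE; exact: (le_bigmax _ _ (ord0, i)). Qed.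

(** The cones are orthants: two reals of the same sign differ by at most the larger of their
    absolute values. *)
Lemma linf_cone_coloring n :
  cone_coloring (@linfnorm R n) (fun v => [ffun i => 0 <= v ord0 i]).
Proof.
move=> u v /ffunP uv leuv; apply: linfnorm_le => [|i]; first exact: normr_ge0.
have := uv i; rewrite !ffunE !mxE.
have := coord_le_linfnorm v i; have := le_trans (coord_le_linfnorm u i) leuv.
rewrite !ler_norml => /andP[? ?] /andP[? ?].
case: (lerP 0 (u ord0 i)) => u0; case: (lerP 0 (v ord0 i)) => v0 // _; apply/andP; lra.
Qed.

Lemma linfnormN n (v : 'rV[R]_n) : linfnorm (- v) = linfnorm v.
Proof. exact: normrN. Qed.

Lemma linfnorm_row_mxl n p (u : 'rV[R]_n) (v : 'rV[R]_p) :
  linfnorm u <= linfnorm (row_mx u v).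
Proof.
apply: linfnorm_le => [|i]; first exact: normr_ge0.
by rewrite -(row_mxEl u v); exact: coord_le_linfnorm.
Qed.

Lemma linfnorm_row_mxr n p (u : 'rV[R]_n) (v : 'rV[R]_p) :
  linfnorm v <= linfnorm (row_mx u v).
Proof.
apply: linfnorm_le => [|i]; first exact: normr_ge0.
by rewrite -(row_mxEr u v); exact: coord_le_linfnorm.
Qed.

Lemma l2norm_ge0 n (v : 'rV[R]_n) : 0 <= l2norm v.
Proof. exact: sqrtr_ge0. Qed.

Lemma l2norm_sqr n (v : 'rV[R]_n) : l2norm v ^+ 2 = \sum_i v ord0 i ^+ 2.
Proof. by rewrite sqr_sqrtr// sumr_ge0// => i _; rewrite sqr_ge0. Qed.

Lemma l2normN n (v : 'rV[R]_n) : l2norm (- v) = l2norm v.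
Proof. by congr Num.sqrt; apply: eq_bigr => i _; rewrite mxE sqrrN. Qed.

Lemma l2norm_row_mxl n p (u : 'rV[R]_n) (v : 'rV[R]_p) :
  l2norm u <= l2norm (row_mx u v).
Proof.
apply: ler_wsqrtr; rewrite big_split_ord/=.
under [X in _ <= X + _]eq_bigr do rewrite row_mxEl.
by rewrite lerDl sumr_ge0// => i _; rewrite sqr_ge0.
Qed.

Lemma l2norm_row_mxr n p (u : 'rV[R]_n) (v : 'rV[R]_p) :
  l2norm v <= l2norm (row_mx u v).
Proof.
apply: ler_wsqrtr; rewrite big_split_ord/=.
under [X in _ <= _ + X]eq_bigr do rewrite row_mxEr.
by rewrite lerDr sumr_ge0// => i _; rewrite sqr_ge0.
Qed.

Lemma coord_le_l2norm n (v : 'rV[R]_n) i : `|v ord0 i| <= l2norm v.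
Proof.
rewrite -[leLHS]sqrtr_sqr ler_wsqrtr//.
by rewrite (bigD1 i)//= lerDl sumr_ge0// => j _; rewrite sqr_ge0.
Qed.

Lemma l2norm_eq0 n (v : 'rV[R]_n) : l2norm v = 0 -> v = 0.
Proof.
move=> v0; apply/rowP => i; rewrite mxE; apply/eqP.
by rewrite -normr_le0 -v0 coord_le_l2norm.
Qed.

(* Rounding the direction v / |v| to a grid of mesh 1/(n+1) makes two vectors of
   the same color form an angle of at most 60 degrees. *)
Definition l2_cell n (v : 'rV[R]_n) (i : 'I_n) : nat :=
  Num.trunc ((v ord0 i / l2norm v + 1) * n.+1%:R).

Definition l2_color n (v : 'rV[R]_n) : {ffun 'I_n -> 'I_(2 * n.+1).+1} :=
  [ffun i => inord (l2_cell v i)].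

Lemma l2_unit_coord n (v : 'rV[R]_n) i : `|v ord0 i / l2norm v| <= 1.
Proof.
rewrite normrM normfV (ger0_norm (l2norm_ge0 _)).
have [->|v0] := eqVneq (l2norm v) 0; first by rewrite invr0 mulr0.
by rewrite ler_pdivrMr ?mul1r ?coord_le_l2norm// lt_neqAle eq_sym v0 l2norm_ge0.
Qed.

Lemma l2_cell_le n (v : 'rV[R]_n) i : (l2_cell v i < (2 * n.+1).+1)%N.
Proof.
have := l2_unit_coord v i; rewrite ler_norml => /andP[v1 v2].
have c0 : 0 <= (v ord0 i / l2norm v + 1) * n.+1%:R.
  by rewrite mulr_ge0//; lra.
have /andP[+ _] := Num.Theory.trunc_itv c0; rewrite -/(l2_cell v i) => le.
rewrite ltnS -(ler_nat R) (le_trans le)// natrM ler_wpM2r//; lra.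
Qed.

Lemma l2_color_close n (u v : 'rV[R]_n) i : l2_color u = l2_color v ->
  `|u ord0 i / l2norm u - v ord0 i / l2norm v| <= n.+1%:R^-1.
Proof.
move=> /ffunP/(_ i); rewrite !ffunE => /(congr1 val).
rewrite /= !inordK ?l2_cell_le// => E.
have c0 (t : 'rV[R]_n) : 0 <= (t ord0 i / l2norm t + 1) * n.+1%:R.
  by have := l2_unit_coord t i; rewrite ler_norml => /andP[? _]; rewrite mulr_ge0//; lra.
have := Num.Theory.trunc_itv (c0 u); have := Num.Theory.trunc_itv (c0 v).
rewrite -/(l2_cell u i) -/(l2_cell v i) E.
set a := u ord0 i / _; set b := v ord0 i / _; set c : R := n.+1%:R.
rewrite -natr1 => /andP[b1 b2] /andP[a1 a2].
have n0 : 0 < c by rewrite ltr0n.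
rewrite -[leRHS]mul1r ler_pdivlMr// -{1}(gtr0_norm n0) -normrM ler_norml; apply/andP; lra.
Qed.

(** Equal colors put the unit directions [a] and [b] at distance at most 1, so twice their inner
    product is at least 1. In the expansion of [|u - v|^2] the cross term then removes at least
    [|u| |v| >= |u|^2], which leaves at most [|v|^2]. *)
Lemma l2_cone_coloring n : cone_coloring (@l2norm R n) (@l2_color n).
Proof.
move=> u v uv leuv.
have [u0|u0] := eqVneq (l2norm u) 0; first by rewrite (l2norm_eq0 u0) sub0r l2normN.
have u_gt0 : 0 < l2norm u by rewrite lt_neqAle eq_sym u0 l2norm_ge0.
have v_gt0 : 0 < l2norm v := lt_le_trans u_gt0 leuv.
rewrite -(ler_pXn2r (n := 2))// ?nnegrE ?l2norm_ge0// l2norm_sqr.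
pose a i := u ord0 i / l2norm u; pose b i := v ord0 i / l2norm v.
have unit (t : 'rV[R]_n) : 0 < l2norm t -> \sum_i (t ord0 i / l2norm t) ^+ 2 = 1.
  move=> t0; under eq_bigr do rewrite exprMn.
  by rewrite -mulr_suml -l2norm_sqr -exprMn divff ?gt_eqF// expr1n.
have uE i : u ord0 i = l2norm u * a i by rewrite mulrC divfK ?gt_eqF.
have vE i : v ord0 i = l2norm v * b i by rewrite mulrC divfK ?gt_eqF.
(* Each of the [n] squares is at most [1/(n+1)^2 <= 1/(n+1)], so the sum stays below 1. *)
have ab : \sum_i (a i - b i) ^+ 2 <= 1.
  apply: (@le_trans _ _ (\sum_(i < n) n.+1%:R^-1)).
    apply: ler_sum => i _.
    have := l2_color_close i uv; rewrite -/(a i) -/(b i) => abi.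
    rewrite -real_normK ?num_real// expr2 -[leRHS]mulr1 ler_pM//.
    by rewrite (le_trans abi)// invf_le1// ler1n.
  rewrite sumr_const card_ord -[leLHS]mulr_natl ler_pdivrMr// mul1r ler_nat.
  exact: leqnSn.
have dot : 1 <= 2 * \sum_i a i * b i.
  have E : \sum_i (a i - b i) ^+ 2 = \sum_i a i ^+ 2 + \sum_i b i ^+ 2 - 2 * \sum_i a i * b i.
    by rewrite mulr_sumr -big_split/= -sumrB; apply: eq_bigr => i _; ring.
  by move: (unit u u_gt0) (unit v v_gt0) => U V; rewrite U V in E; lra.
have -> : \sum_i (u - v) ord0 i ^+ 2 =
    l2norm u ^+ 2 + l2norm v ^+ 2 - l2norm u * l2norm v * (2 * \sum_i a i * b i).
  rewrite !l2norm_sqr mulr_sumr mulr_sumr -big_split/= -sumrB.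
  by apply: eq_bigr => i _; rewrite !mxE !uE !vE; ring.
have h1 : l2norm u ^+ 2 <= l2norm u * l2norm v by rewrite expr2 ler_wpM2l// ltW.
have h2 := ler_peMr (mulr_ge0 (ltW u_gt0) (ltW v_gt0)) dot.
by move: h1 h2; lra.
Qed.

End norms.

(** * Influence of one sample point *)

Lemma nth_sorted_le (R : realDomainType) (s : seq R) r k :
  sorted <=%R s -> (k < size s)%N ->
  (nth 0 s k <= r) = (k < count (fun x => (x <= r)%R) s)%N.
Proof.
elim: s k => [|a s IH] k //= pas.
have srt := path_sorted pas.
have [ar|ra] := lerP a r.
  by case: k => [|k] //=; rewrite ltnS add1n ltnS => /(IH _ srt).
have all_gt : all (fun x => ~~ (x <= r)) s.
  apply/allP => x xs; rewrite -ltNge (lt_le_trans ra)//.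
  by have /allP := order_path_min le_trans pas; exact.
have -> : count (fun x => x <= r) s = 0%N.
  by apply/eqP; rewrite -leqn0 leqNgt -has_count -all_predC.
case: k => [|k] /=; first by rewrite leNgt ra.
rewrite ltnS => ks; apply/negbTE.
by have /allP := all_gt; apply; exact: mem_nth.
Qed.

Section perturbation.
Variables (R : realType) (nu : forall n, 'rV[R]_n -> R).
Hypothesis nuN : forall n (v : 'rV[R]_n), nu (- v) = nu v.
Hypothesis nu_row_mxl : forall n p (u : 'rV[R]_n) (v : 'rV[R]_p), nu u <= nu (row_mx u v).
Hypothesis nu_row_mxr : forall n p (u : 'rV[R]_n) (v : 'rV[R]_p), nu v <= nu (row_mx u v).

(** Lets every later argument on nearest neighbor distances be a count of neighbors. The bound
    [k < N] keeps the index [k.-1] inside the sorted list of [N - 1] distances, so the default of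
    [nth] is never read. *)
Lemma knn_dist_le dx dy k N (x : nat -> 'rV[R]_dx) (y : nat -> 'rV[R]_dy) (i : 'I_N) r :
  (0 < k < N)%N ->
  (knn_dist k x y nu i <= r) = (k <= nb_within nu (fun j => row_mx (x j) (y j)) r i)%N.
Proof.
move=> /andP[k0 kN]; rewrite /knn_dist /nb_within.
set s := [seq _ | j <- _ & _].
have cardE (p : pred 'I_N) : count p (enum 'I_N) = #|[set j | p j]%SET|.
  by rewrite cardsE cardE /enum_mem size_filter count_filter; apply: eq_count => j; rewrite inE andbT.
have sz : size s = N.-1.
  rewrite size_map size_filter cardE.
  have := cardC1 i; rewrite card_ord => <-.
  by apply: eq_card => j; rewrite !inE.
rewrite nth_sorted_le; [|exact: sort_le_sorted|by rewrite size_sort sz; lia].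
rewrite prednK// count_sort /s count_map count_filter cardE.
by congr (_ <= _)%N; apply: eq_card => j; rewrite !inE andbC.
Qed.

(** Ignoring [l] makes the count, at a given radius, common to the original and the modified
    sample. *)
Definition nb_except N n (u : nat -> 'rV[R]_n) (r : R) (i l : 'I_N) : nat :=
  #|[set j : 'I_N | [&& j != i, j != l & nu (u j - u i) <= r]]%SET|.

Lemma nb_within_except N n (u : nat -> 'rV[R]_n) r (i l : 'I_N) : i != l ->
  nb_within nu u r i = (nb_except u r i l + (nu (u l - u i) <= r)%R)%N.
Proof.
move=> il; rewrite /nb_within (cardsD1 l) inE eq_sym il/= addnC; congr (_ + _)%N.
by apply: eq_card => j; rewrite !inE andbCA.
Qed.

Lemma eq_nb_except N n (u u' : nat -> 'rV[R]_n) r (i l : 'I_N) : i != l ->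
  (forall j : 'I_N, j != l -> u j = u' j) -> nb_except u r i l = nb_except u' r i l.
Proof.
move=> il uu'; apply: eq_card => j; rewrite !inE (uu' i)//.
by have [->|jl] := eqVneq j l; rewrite ?andbF// (uu' j).
Qed.

(** The cone property places every selected point of the color of [i] that is no farther from [l]
    inside the ball of radius [rad i], so [nb_except] dominates the rank of [i] in its class. The
    radii are arbitrary: the joint and both marginal spaces are treated with the same ones. *)
Lemma near_sum N n (C : finType) (col : 'rV[R]_n -> C) (u : nat -> 'rV[R]_n)
    (rad : 'I_N -> R) (l : 'I_N) (p : pred 'I_N) (w : nat -> R) :
  cone_coloring (@nu n) col ->
  {homo w : a b / (a <= b)%N >-> b <= a} -> (forall j, 0 <= w j) ->
  (forall i, p i -> i != l) ->
  (forall i, p i -> nu (u l - u i) <= rad i) ->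
  \sum_(i | p i) w (nb_except u (rad i) i l) <= #|C|%:R * \sum_(j < N) w j.
Proof.
move=> cone w_anti w0 pl pnear; pose B := [set i | p i]%SET.
rewrite (eq_bigl (fun i => i \in B)); last by move=> i; rewrite inE.
have := @colored_rank_sum _ C R (fun i : 'I_N => col (u i - u l)) B
  (fun i => nu (u i - u l)) (fun i => nb_except u (rad i) i l) w w_anti w0.
rewrite card_ord; apply=> i; rewrite inE => pi.
apply/subset_leq_card/fintype.subsetP => j; rewrite !inE.
move=> /and4P[pj -> /eqP cji Dji]; rewrite pl//=.
apply: le_trans (pnear i pi).
have := cone _ _ cji Dji.
by rewrite opprB addrA subrK -[X in _ <= X]nuN opprB.
Qed.

Section estimator.
Variables (dx dy k N : nat) (phi : nat -> R) (K a : R).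
Hypothesis k_gt0 : (0 < k)%N.
Hypothesis k_ltN : (k < N)%N.
Hypothesis phi_step : forall m, (0 < m)%N -> `|phi m.+1 - phi m| <= m%:R^-1.

(** Common form of both estimators: [phi n] stands for psi(n + 1) or log n, [K] collects the terms
    independent of the sample, and [a] is the truncation radius. *)
Definition ksg_term (x : nat -> 'rV[R]_dx) (y : nat -> 'rV[R]_dy) (i : 'I_N) : R :=
  let rho := knn_dist k x y nu i in
  if rho <= a then K - phi (nb_within nu x rho i) - phi (nb_within nu y rho i) else 0.

(* The plain 1/m is 0 at m = 0, hence not antitone. *)
Definition inv_max1 (m : nat) : R := (maxn 1 m)%:R^-1.

Lemma inv_max1_ge0 m : 0 <= inv_max1 m. Proof. by rewrite /inv_max1 invr_ge0. Qed.

Lemma inv_max1_anti : {homo inv_max1 : m n / (m <= n)%N >-> n <= m}.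
Proof.
move=> m n mn; rewrite /inv_max1 lef_pV2 ?posrE ?ltr0n ?leq_max//.
by rewrite ler_nat geq_max leq_max/= leq_max mn !orbT.
Qed.

Definition harmonic_sum : R := \sum_(j < N) inv_max1 j.

(** The increments telescope down to [phi 1]. The value [phi 0] enters separately because [phi_step]
    says nothing about the step from 0 to 1. *)
Lemma phi_bound m : (m <= N)%N -> `|phi m| <= `|phi 0| + `|phi 1| + harmonic_sum.
Proof.
move=> mN; apply: (@le_trans _ _ (`|phi 0| + `|phi 1| + \sum_(j < m) inv_max1 j)); last first.
  rewrite lerD2l /harmonic_sum -(big_mkord predT inv_max1) -[leRHS](big_mkord predT inv_max1).
  by rewrite [leRHS](big_cat_nat (n := m))//= lerDl sumr_ge0// => j _; exact: inv_max1_ge0.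
elim: m {mN} => [|[|m] IH].
- by rewrite big_ord0 addr0 lerDl.
- by rewrite big_ord1 -addrA addrCA lerDl addr_ge0// inv_max1_ge0.
- have := ler_normD (phi m.+1) (phi m.+2 - phi m.+1).
  rewrite addrCA subrr addr0 => /le_trans; apply.
  rewrite big_ord_recr/= addrA lerD//.
  by rewrite (le_trans (phi_step _))// /inv_max1 (maxn_idPr _).
Qed.

Definition ksg_bound : R := `|K| + (`|phi 0| + `|phi 1| + harmonic_sum) *+ 2.

Lemma nb_within_le n (u : nat -> 'rV[R]_n) r (i : 'I_N) : (nb_within nu u r i <= N)%N.
Proof. by rewrite -[leqRHS](card_ord N) max_card. Qed.

Lemma ksg_term_le x y i : `|ksg_term x y i| <= ksg_bound.
Proof.
rewrite /ksg_term; case: ifP => _; last first.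
  by rewrite normr0 addr_ge0// mulrn_wge0// addr_ge0 ?addr_ge0// sumr_ge0// => j _; exact: inv_max1_ge0.
rewrite /ksg_bound mulr2n addrA (le_trans (ler_normB _ _))// lerD//; last exact/phi_bound/nb_within_le.
by rewrite (le_trans (ler_normB _ _))// lerD//; exact/phi_bound/nb_within_le.
Qed.

Section change_one_sample.
Variables (x x' : nat -> 'rV[R]_dx) (y y' : nat -> 'rV[R]_dy) (l : 'I_N).
Hypothesis xx' : forall j : 'I_N, j != l -> x j = x' j.
Hypothesis yy' : forall j : 'I_N, j != l -> y j = y' j.

Let z j := row_mx (x j) (y j).
Let z' j := row_mx (x' j) (y' j).

(** Each of the two balls holds [k] neighbors other than [l], and these are the same points in both
    samples. So each radius is admissible for the other sample, which gives both inequalities. *)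
Lemma stable_knn_dist (i : 'I_N) : i != l ->
  (k <= nb_except z (knn_dist k x y nu i) i l)%N ->
  (k <= nb_except z' (knn_dist k x' y' nu i) i l)%N ->
  knn_dist k x y nu i = knn_dist k x' y' nu i.
Proof.
have kN : (0 < k < N)%N by rewrite k_gt0.
have zz' (j : 'I_N) : j != l -> z j = z' j by move=> jl; rewrite /z /z' xx'// yy'.
move=> il st st'; apply/eqP; rewrite eq_le !knn_dist_le//.
rewrite -/z -/z' !(@nb_within_except _ _ _ _ i l)//.
rewrite [X in (_ <= X + _)%N](eq_nb_except _ il zz') (leq_trans st' (leq_addr _ _))/=.
by rewrite -(eq_nb_except _ il zz') (leq_trans st (leq_addr _ _)).
Qed.

End change_one_sample.

Section influence.
Variables (x : nat -> 'rV[R]_dx) (y : nat -> 'rV[R]_dy) (l : 'I_N).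

Let z j := row_mx (x j) (y j).
Let rho (i : 'I_N) := knn_dist k x y nu i.

(* Removing l does not change the k-th nearest neighbor distance of i. *)
Definition stable (i : 'I_N) := (k <= nb_except z (rho i) i l)%N.

Definition near_term n (u : nat -> 'rV[R]_n) (i : 'I_N) : R :=
  if nu (u l - u i) <= rho i then inv_max1 (nb_except u (rho i) i l) else 0.

(** Share of the change at [i] charged to one of the two samples. An unstable index is charged the
    largest possible gap between two terms. *)
Definition influence (i : 'I_N) : R :=
  if stable i then near_term x i + near_term y i else ksg_bound *+ 2.

(** The ball of radius [rho i] holds at least [k] neighbors, but fewer than [k] without [l], so [l]
    is one of them. *)
Lemma unstable_near i : i != l -> ~~ stable i -> nu (z l - z i) <= rho i.
Proof.
move=> il; rewrite /stable -ltnNge => unst.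
have kN : (0 < k < N)%N by rewrite k_gt0.
have := knn_dist_le x y i (rho i) kN; rewrite lexx -/z => /esym.
rewrite (nb_within_except _ _ il); case: (nu (z l - z i) <= rho i) => //=; lia.
Qed.

Lemma near_term_ge0 n (u : nat -> 'rV[R]_n) i : 0 <= near_term u i.
Proof. by rewrite /near_term; case: ifP => _ //; exact: inv_max1_ge0. Qed.

Lemma near_term_sum n (u : nat -> 'rV[R]_n) (C : finType) (col : 'rV[R]_n -> C) :
  cone_coloring (@nu n) col ->
  \sum_(i | i != l) near_term u i <= #|C|%:R * harmonic_sum.
Proof.
move=> cone; rewrite /near_term -big_mkcondr/=.
by apply: (near_sum cone inv_max1_anti inv_max1_ge0) => i /andP[].
Qed.

Lemma unstable_sum (C : finType) (col : 'rV[R]_(dx + dy) -> C) :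
  cone_coloring (@nu (dx + dy)) col ->
  \sum_(i | i != l) (~~ stable i)%:R <= #|C|%:R * k%:R :> R.
Proof.
move=> cone.
(* An unstable index has [nb_except] below [k], hence weight 1, and this antitone weight sums to
   [k]. *)
pose w (m : nat) : R := (m < k)%:R.
have w_anti : {homo w : m n / (m <= n)%N >-> n <= m}.
  move=> m n mn; rewrite /w ler_nat; case: (ltnP n k) => // nk.
  by rewrite (leq_ltn_trans mn nk).
have := @near_sum _ _ _ _ z rho l (fun i => (i != l) && ~~ stable i) w cone w_anti (fun=> ler0n _ _).
have -> : \sum_(j < N) w j = k%:R.
  rewrite -(big_mkord predT w) (big_cat_nat (n := k))//=; last exact: ltnW.
  rewrite (eq_big_nat _ _ (F2 := fun=> 1)); last first.
    by move=> j /andP[_ jk]; rewrite /w jk.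
  rewrite [X in _ + X]big_nat_cond [X in _ + X]big1 ?addr0.
    by rewrite sumr_const_nat subn0.
  by move=> j /andP[/andP[kj _] _]; rewrite /w ltnNge kj.
move=> H; apply: le_trans; last apply: H.
- rewrite [leRHS]big_mkcondr/=; apply: ler_sum => i il.
  by case: (boolP (stable i)) => st /=; rewrite ?lexx// /w ltnNge -/(stable i) st.
- by move=> i /andP[].
- by move=> i /andP[]; exact: unstable_near.
Qed.

Lemma influence_sum (Cz Cx Cy : finType) (colz : 'rV[R]_(dx + dy) -> Cz)
    (colx : 'rV[R]_dx -> Cx) (coly : 'rV[R]_dy -> Cy) :
  cone_coloring (@nu (dx + dy)) colz ->
  cone_coloring (@nu dx) colx -> cone_coloring (@nu dy) coly ->
  \sum_(i | i != l) influence i <=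
    (#|Cx| + #|Cy|)%:R * harmonic_sum + (#|Cz| * k)%:R * (ksg_bound *+ 2).
Proof.
move=> cz cx cy.
have M0 : 0 <= ksg_bound *+ 2.
  by rewrite mulrn_wge0// (le_trans _ (ksg_term_le x y l)).
apply: (@le_trans _ _ (\sum_(i | i != l)
   ((near_term x i + near_term y i) + (~~ stable i)%:R * (ksg_bound *+ 2)))).
  apply: ler_sum => i il; rewrite /influence; case: stable => /=.
    by rewrite mul0r addr0.
  by rewrite mul1r lerDr addr_ge0// near_term_ge0.
rewrite !big_split/= natrD mulrDl natrM -mulr_suml lerD//.
  by rewrite lerD//; [exact: (near_term_sum x cx)|exact: (near_term_sum y cy)].
by rewrite ler_wpM2r//; exact: (unstable_sum cz).
Qed.

End influence.

Lemma phi_flip m (b b' : bool) : (0 < m)%N ->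
  `|phi (m + b)%N - phi (m + b')%N| <= (if b then inv_max1 m else 0) + (if b' then inv_max1 m else 0).
Proof.
move=> m0; have inv_max1E : inv_max1 m = m%:R^-1 by rewrite /inv_max1 (maxn_idPr m0).
case: b; case: b'; rewrite ?addn1 ?addn0 ?subrr ?normr0 ?addr0 ?add0r ?addr_ge0 ?inv_max1_ge0//.
  by rewrite inv_max1E phi_step.
by rewrite distrC inv_max1E phi_step.
Qed.

Lemma influence_ge0 x y l i : 0 <= influence x y l i.
Proof.
rewrite /influence; case: ifP => _; first by rewrite addr_ge0// near_term_ge0.
by rewrite mulrn_wge0// (le_trans _ (ksg_term_le x y i)).
Qed.

(** Projecting to a marginal space does not increase the norm, so the [k >= 1] joint neighbors
    remain marginal neighbors. Positivity is what [phi_step] asks for. *)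
Lemma stable_nb_except (x : nat -> 'rV[R]_dx) (y : nat -> 'rV[R]_dy) (l i : 'I_N) r :
  (k <= nb_except (fun j => row_mx (x j) (y j)) r i l)%N ->
  (0 < nb_except x r i l)%N /\ (0 < nb_except y r i l)%N.
Proof.
move=> /(leq_trans k_gt0) st; split; apply: leq_trans st _;
  apply/subset_leq_card/fintype.subsetP => j; rewrite !inE opp_row_mx add_row_mx;
  move=> /and3P[-> -> ]; apply: le_trans.
- exact: nu_row_mxl.
- exact: nu_row_mxr.
Qed.

Lemma ksg_term_change (x x' : nat -> 'rV[R]_dx) (y y' : nat -> 'rV[R]_dy) (l i : 'I_N) :
  (forall j : 'I_N, j != l -> x j = x' j) ->
  (forall j : 'I_N, j != l -> y j = y' j) -> i != l ->
  `|ksg_term x y i - ksg_term x' y' i| <= influence x y l i + influence x' y' l i.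
Proof.
move=> xx' yy' il.
have crude : `|ksg_term x y i - ksg_term x' y' i| <= ksg_bound *+ 2.
  by rewrite (le_trans (ler_normB _ _))// mulr2n lerD// ksg_term_le.
have [st|st] := boolP (stable x y l i); last first.
  rewrite (le_trans crude)// {1}/influence (negbTE st) lerDl influence_ge0//.
have [st'|st'] := boolP (stable x' y' l i); last first.
  rewrite (le_trans crude)// {2}/influence (negbTE st') lerDr influence_ge0//.
(* With both samples stable at [i] the radius is common. The marginal counts without [l] then
   coincide, and only the membership of [l] can differ. *)
have rr' := stable_knn_dist xx' yy' il st st'.
rewrite /influence st st' /near_term.
rewrite /ksg_term -rr'; set r := knn_dist k x y nu i.
have [mx my] := stable_nb_except st.
have -> : nb_except x' r i l = nb_except x r i l by exact/esym/(eq_nb_except _ il xx').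
have -> : nb_except y' r i l = nb_except y r i l by exact/esym/(eq_nb_except _ il yy').
rewrite !(nb_within_except _ _ il).
rewrite -(eq_nb_except _ il xx') -(eq_nb_except _ il yy').
case: ifP => _; last first.
  by rewrite subrr normr0 !addr_ge0//; case: ifP => // _; exact: inv_max1_ge0.
set fx := phi _; set fy := phi (_ + (nu (y l - _) <= r)%R)%N.
set fx' := phi (_ + (nu (x' l - _) <= r)%R)%N; set fy' := phi _.
have -> : K - fx - fy - (K - fx' - fy') = - (fx - fx') - (fy - fy') by ring.
rewrite (le_trans (ler_normB _ _))// normrN addrACA lerD//.
  by rewrite (le_trans (phi_flip _ _ mx))// xx'.
by rewrite (le_trans (phi_flip _ _ my))// yy'.
Qed.

Lemma sum_ksg_term_change (x x' : nat -> 'rV[R]_dx) (y y' : nat -> 'rV[R]_dy) (l : 'I_N)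
    (Cz Cx Cy : finType) (colz : 'rV[R]_(dx + dy) -> Cz)
    (colx : 'rV[R]_dx -> Cx) (coly : 'rV[R]_dy -> Cy) :
  cone_coloring (@nu (dx + dy)) colz ->
  cone_coloring (@nu dx) colx -> cone_coloring (@nu dy) coly ->
  (forall j : 'I_N, j != l -> x j = x' j) ->
  (forall j : 'I_N, j != l -> y j = y' j) ->
  `|\sum_i ksg_term x y i - \sum_i ksg_term x' y' i| <=
    ksg_bound *+ 2 +
    ((#|Cx| + #|Cy|)%:R * harmonic_sum + (#|Cz| * k)%:R * (ksg_bound *+ 2)) *+ 2.
Proof.
move=> cz cx cy xx' yy'.
(* The term of [l] itself is not controlled by [influence] and is bounded crudely. *)
rewrite -sumrB (bigD1 l)//= (le_trans (ler_normD _ _))// lerD//.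
  by rewrite (le_trans (ler_normB _ _))// mulr2n lerD// ksg_term_le.
rewrite (le_trans (ler_norm_sum _ _ _))//.
apply: (@le_trans _ _ (\sum_(i | i != l) (influence x y l i + influence x' y' l i))).
  by apply: ler_sum => i il; exact: ksg_term_change.
by rewrite big_split/= mulr2n lerD//; exact: (influence_sum _ _ _ cz cx cy).
Qed.

End estimator.
End perturbation.

(** * Increments of the digamma function *)

Section digamma.
Variable R : realType.
Local Notation mu := (@lebesgue_measure R).

Definition gamma_integrand (s t : R) : R := t `^ (s - 1) * expR (- t).

Lemma measurable_gamma_integrand s : measurable_fun setT (gamma_integrand s).
Proof.
apply: measurable_funM; first exact: measurable_powR.
by apply: measurableT_comp; [exact: measurable_expR|exact: measurable_funN].
Qed.

(** With [p = s + 1], raising [n/p <= exp(n/p)] to the power [p] gives [n^p <= p^p exp(n)]. The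
    extra power of [n] yields the factor [harmonic n]. *)
Lemma powR_mul_expRN_cvg0 (s : R) : 0 < s ->
  (n.+1%:R `^ s * expR (- n.+1%:R) : R) @[n --> \oo] --> (0 : R).
Proof.
move=> s0; pose p := s + 1; have p0 : 0 < p by rewrite /p; lra.
apply: (@squeeze_cvgr _ _ _ _ (fun=> 0) (fun n => p `^ p * harmonic n)).
- near=> n; rewrite mulr_ge0 ?powR_ge0 ?expR_ge0//=.
  have n0 : 0 < n.+1%:R :> R by rewrite ltr0n.
  have le1 : (n.+1%:R / p) `^ p <= expR n.+1%:R.
    rewrite -{2}[n.+1%:R](@divfK _ p) ?gt_eqF// expRM ge0_ler_powR ?nnegrE ?ltW ?divr_gt0 ?expR_gt0//.
    by rewrite (lt_le_trans _ (expR_ge1Dx _))// ltrDr.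
  rewrite expRN ler_pdivrMr ?expR_gt0//; apply: le_trans (ler_wpM2l _ le1); last first.
    by rewrite mulr_ge0 ?powR_ge0 ?invr_ge0.
  have pp0 : p `^ p != 0 by rewrite gt_eqF// powR_gt0.
  have nE : n.+1%:R `^ p = n.+1%:R * n.+1%:R `^ s.
    by rewrite -(mulr_powRB1 _ p0)// /p addrK.
  rewrite powRM ?invr_ge0 ?(ltW p0)// nE -[p^-1]powR_inv1 ?(ltW p0)// -powRrM mulN1r powRN /harmonic/=.
  rewrite le_eqVlt; apply/orP; left; apply/eqP; field.
  by rewrite pp0 nat1r pnatr_eq0.
- exact: cvg_cst.
- rewrite -[X in _ --> X](mulr0 (p `^ p)); apply: cvgM; first exact: cvg_cst.
  exact: cvg_harmonic.
Unshelve. all: by end_near. Qed.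

(** Integration by parts on [[0, b]], where [1 < s] makes [t^(s-1)] continuous at 0. The boundary
    term stands on the left, so no difference of extended reals occurs. *)
Lemma gamma_integrand_parts (s b : R) : 1 < s -> 0 < b ->
  (\int[mu]_(t in `[0%R, b]) (gamma_integrand (s + 1) t)%:E + (b `^ s * expR (- b))%:E =
  s%:E * \int[mu]_(t in `[0%R, b]) (gamma_integrand s t)%:E)%E.
Proof.
move=> s1 b0.
have ct q t : 0 < t -> {for t, continuous (fun t : R => t `^ q)}.
  move=> t0; apply: differentiable_continuous; apply/derivable1_diffP.
  by apply: derivable_powR; rewrite in_itv/= t0.
have cpow q : 0 < q -> {within `[0, b], continuous (fun t : R => t `^ q)}.
  move=> q0; apply/continuous_within_itvP => //; split.
  - by move=> t; rewrite in_itv/= => /andP[t0 _]; exact: ct.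
  - by rewrite powR0 ?gt_eqF//; exact: powR_cvg0.
  - by apply: cvg_at_left_filter; exact: ct.
have s0 : 0 < s by lra.
have cexp : continuous (fun t : R => expR (- t)).
  by move=> t; apply: continuous_comp; [exact: continuousN|exact: continuous_expR].
have dN (t : R) : is_derive t 1 (fun t : R => - expR (- t)) (expR (- t)).
  by apply: is_derive_eq; ring.
have := @integration_by_parts R (fun t => t `^ s) (fun t => - expR (- t))
  (fun t => s * t `^ (s - 1)) (fun t => expR (- t)) 0 b b0.
have -> : (\int[mu]_(t in `[0%R, b]) (t `^ s * expR (- t))%:E =
    \int[mu]_(t in `[0%R, b]) (gamma_integrand (s + 1) t)%:E)%E.
  by apply: eq_integral => t _; rewrite /gamma_integrand addrK.
have -> : (\int[mu]_(t in `[0%R, b]) (s * t `^ (s - 1) * - expR (- t))%:E =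
    - (s%:E * \int[mu]_(t in `[0%R, b]) (gamma_integrand s t)%:E))%E.
  have mg : measurable_fun `[0, b] (gamma_integrand s).
    by apply: measurable_funTS; exact: measurable_gamma_integrand.
  rewrite -ge0_integralZl//;
    [|exact/measurable_EFinP|by move=> t _; rewrite lee_fin mulr_ge0 ?powR_ge0 ?expR_ge0
     |by rewrite lee_fin ltW].
  rewrite -integral_ge0N//; last first.
    by move=> t _; rewrite -EFinM lee_fin mulr_ge0 ?(ltW s0)// mulr_ge0 ?powR_ge0 ?expR_ge0.
  by apply: eq_integral => t _; rewrite /gamma_integrand -EFinM -EFinN mulrN mulrA.
rewrite powR0 ?gt_eqF// mul0r subr0 mulrN oppeK => ->.
- by rewrite addeAC -EFinD addNr add0e.
- apply/subspace_continuousP => t tab; apply: cvgM; first exact: cvg_cst.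
  have s10 : 0 < s - 1 by rewrite subr_gt0.
  by have /subspace_continuousP := cpow _ s10; exact.
- split.
  + by move=> t; rewrite in_itv/= => /andP[t0 _]; apply: derivable_powR; rewrite in_itv/= t0.
  + by rewrite powR0 ?gt_eqF//; exact: powR_cvg0.
  + by apply: cvg_at_left_filter; exact: ct.
- by move=> t; rewrite in_itv/= => /andP[t0 _]; rewrite powR_derive1// in_itv/= t0.
- exact: continuous_subspaceT.
- have dG t : {for t, continuous (fun t : R => - expR (- t))}.
    by apply: differentiable_continuous; apply/derivable1_diffP; case: (dN t).
  split.
  + by move=> t _; case: (dN t).
  + by apply: cvg_at_right_filter; exact: dG.
  + by apply: cvg_at_left_filter; exact: dG.
- by move=> t _; rewrite derive1E; case: (dN t).
Qed.

(** The integration by parts is taken along [b = n + 1]: monotone convergence handles the integrals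
    and the boundary term vanishes. *)
Lemma GammaS (s : R) : 1 < s -> Gamma (s + 1) = s * Gamma s.
Proof.
move=> s1.
pose S n := `]0%R, (n.+1%:R : R)]%classic.
have SU : \bigcup_n S n = `]0, +oo[%classic.
  apply/seteqP; split=> [t [n _]|t].
    by rewrite /S/= !in_itv/= => /andP[->].
  rewrite /= in_itv/= andbT => t0; exists (Num.trunc t) => //; rewrite /S/= in_itv/= t0/=.
  by have /andP[_ /ltW] := Num.Theory.trunc_itv (ltW t0).
have mS n : measurable (S n) by exact: measurable_itv.
have mg := measurable_gamma_integrand.
have cvgS q : (\int[mu]_(t in `[0%R, (n.+1%:R)%R]) (gamma_integrand q t)%:E @[n --> \oo] -->
    \int[mu]_(t in `]0%R, +oo[) (gamma_integrand q t)%:E)%E.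
  rewrite -SU; under eq_cvg => n.
    rewrite -integral_itv_obnd_cbnd; last first.
      by apply/measurable_EFinP; apply: measurable_funTS; exact: mg.
    over.
  apply: ge0_nondecreasing_set_cvg_integral => //.
  - apply/nondecreasing_seqP => n; rewrite subsetEset; apply: subset_itvl.
    by rewrite bnd_simp ler_nat.
  - by move=> n; apply/measurable_EFinP; apply: measurable_funTS; exact: mg.
  - by move=> n t _; rewrite lee_fin mulr_ge0 ?powR_ge0 ?expR_ge0.
have E : (\int[mu]_(t in `]0%R, +oo[) (gamma_integrand (s + 1) t)%:E =
    s%:E * \int[mu]_(t in `]0%R, +oo[) (gamma_integrand s t)%:E)%E.
  have c1 : (s%:E * \int[mu]_(t in `[0%R, (n.+1%:R)%R]) (gamma_integrand s t)%:E @[n --> \oo] -->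
      s%:E * \int[mu]_(t in `]0%R, +oo[) (gamma_integrand s t)%:E)%E.
    exact: (cvgeZl _ (cvgS s)).
  have cF : (n.+1%:R `^ s * expR (- n.+1%:R))%:E @[n --> \oo] --> 0%E.
    apply: cvg_EFin; first exact: nearW.
    by apply: powR_mul_expRN_cvg0; lra.
  have c2 : ((\int[mu]_(t in `[0%R, (n.+1%:R)%R]) (gamma_integrand (s + 1) t)%:E +
      (n.+1%:R `^ s * expR (- n.+1%:R))%:E)%E @[n --> \oo] -->
      (\int[mu]_(t in `]0%R, +oo[) (gamma_integrand (s + 1) t)%:E + 0)%E).
    by apply: (cvgeD _ (cvgS (s + 1)) cF); exact: fin_num_adde_defl.
  rewrite -[RHS](cvg_lim _ c1)// -[LHS]adde0 -[LHS](cvg_lim _ c2)//.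
  congr (limn _); apply/funext => n /=; exact: gamma_integrand_parts.
have s0 : 0 < s by lra.
rewrite /Gamma /Rintegral -/(gamma_integrand _ _) E.
have [fin|] := boolP (\int[mu]_(t in `]0%R, +oo[) (gamma_integrand s t)%:E \is a fin_num)%E.
  by rewrite fineM.
(* If the integral is infinite, both sides are the junk value 0. *)
rewrite ge0_fin_numE; last first.
  by apply: integral_ge0 => t _; rewrite lee_fin mulr_ge0 ?powR_ge0 ?expR_ge0.
rewrite -leNgt leye_eq => /eqP ->.
by rewrite mulry gtr0_sg// mul1e mulr0.
Qed.

Lemma derivable_shift (f : R -> R) c a :
  derivable f (a + c) 1 -> derivable (fun t => f (t + c)) a 1.
Proof.
rewrite /derivable; set g1 := fun h => _; set g2 := fun h => _.
suff -> : g1 = g2 by [].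
by apply/funext => h; rewrite /g1 /g2/= addrA.
Qed.

Lemma derive1_shift (f : R -> R) c a :
  derive1 (fun t => f (t + c)) a = derive1 f (a + c).
Proof.
rewrite /derive1; set g1 := fun h => _; set g2 := fun h => _.
suff -> : g1 = g2 by [].
by apply/funext => h; rewrite /g1 /g2/= addrA.
Qed.

(** * Logarithmic derivative under the functional equation of Gamma *)

Section functional_equation.
Variable g : R -> R.
Hypothesis gS : forall t, 1 < t -> g (t + 1) = t * g t.

Let near_gS (a : R) : 1 < a -> \forall t \near a, g (t + 1) = t * g t.
Proof.
by move=> a1; near=> t; apply: gS; near: t; exact: lt_nbhsr.
Unshelve. all: by end_near. Qed.

Lemma derive1_succ (a : R) : 1 < a -> derivable g a 1 ->
  derive1 g (a + 1) = g a + a * derive1 g a.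
Proof.
move=> a1 dg.
rewrite -derive1_shift !derive1E (near_eq_derive _ (near_gS a1)).
rewrite (deriveM (@derivable_id _ _ a 1) dg) derive_id /GRing.scale/=.
by rewrite mulr1 addrC.
Qed.

(** Near [a], [g t] is [t^-1] times the shifted function. The contrapositive carries
    non-derivability from [a] to [a + 1]. *)
Lemma derivable_succ (a : R) : 1 < a -> derivable g (a + 1) 1 -> derivable g a 1.
Proof.
move=> a1 /derivable_shift dgS.
have dtg : derivable (fun t : R => t * g t) a 1.
  exact: near_eq_derivable (near_gS a1) dgS.
apply: (near_eq_derivable (f := fun t : R => t^-1 * (t * g t))).
  near=> t; have t1 : 1 < t by near: t; exact: lt_nbhsr.
  by rewrite mulKf// gt_eqF// (lt_trans ltr01).
apply: derivableM dtg; apply: derivableV; last exact: derivable_id.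
by rewrite gt_eqF// (lt_trans ltr01).
Unshelve. all: by end_near. Qed.

Lemma derive1_junk (a : R) : ~ derivable g a 1 -> derive1 g a = 0.
Proof.
move=> nd; rewrite derive1E; apply: getPN => l cl; apply: nd.
by apply/cvg_ex; exists l.
Qed.

(* Where g is not derivable, [derive1] is the junk value 0, which makes the
   difference vanish as well. *)
Lemma log_derive1S (a : R) : 1 < a ->
  `|derive1 g (a + 1) / g (a + 1) - derive1 g a / g a| <= a^-1.
Proof.
move=> a1; have a_gt0 : 0 < a by exact: lt_trans a1.
have [dg|ndg] := pselect (derivable g a 1).
  rewrite derive1_succ// gS//.
  (* If [g a] vanishes, so does [g (a + 1)], and both quotients are 0 because the inverse of 0 is
     0. *)
  have [g0|g0] := eqVneq (g a) 0.
    by rewrite g0 mulr0 !invr0 !mulr0 subrr normr0 invr_ge0 ltW.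
  rewrite [X in `|X|](_ : _ = a^-1) ?gtr0_norm ?invr_gt0//; field.
  by rewrite g0 gt_eqF.
have ndgS : ~ derivable g (a + 1) 1 by move/(derivable_succ a1).
by rewrite !derive1_junk// !mul0r subrr normr0 invr_ge0 ltW.
Qed.

End functional_equation.

Lemma digammaS n : (1 < n)%N -> `|digamma n.+1%:R - digamma n%:R :> R| <= n%:R^-1.
Proof.
move=> n1; have n1R : 1 < n%:R :> R by rewrite ltr1n.
by rewrite -natr1; exact: log_derive1S GammaS _ n1R.
Qed.

End digamma.

(** * Measurability *)

Section measurability.
Context d (T : measurableType d) (R : realType).

Lemma measurable_fun_rV_sub n (u v : T -> 'rV[R]_n) :
  measurable_fun setT u -> measurable_fun setT v -> measurable_fun setT (fun t => u t - v t).
Proof.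
move=> /measurable_fun_coordP mu /measurable_fun_coordP mv; apply/measurable_fun_coordP => i.
under eq_fun do rewrite !mxE; exact: measurable_funB.
Qed.

Lemma measurable_fun_row_mx n p (u : T -> 'rV[R]_n) (v : T -> 'rV[R]_p) :
  measurable_fun setT u -> measurable_fun setT v ->
  measurable_fun setT (fun t => row_mx (u t) (v t)).
Proof.
move=> /measurable_fun_coordP mu /measurable_fun_coordP mv; apply/measurable_fun_coordP => i.
rewrite -(splitK i); case: (fintype.split i) => j /=.
  by under eq_fun do rewrite row_mxEl; exact: mu.
by under eq_fun do rewrite row_mxEr; exact: mv.
Qed.

Lemma measurable_fun_lsubmx n p (u : T -> 'rV[R]_(n + p)) :
  measurable_fun setT u -> measurable_fun setT (fun t => lsubmx (u t)).
Proof.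
move=> /measurable_fun_coordP mu; apply/measurable_fun_coordP => i.
by under eq_fun do rewrite mxE; exact: mu.
Qed.

Lemma measurable_fun_rsubmx n p (u : T -> 'rV[R]_(n + p)) :
  measurable_fun setT u -> measurable_fun setT (fun t => rsubmx (u t)).
Proof.
move=> /measurable_fun_coordP mu; apply/measurable_fun_coordP => i.
by under eq_fun do rewrite mxE; exact: mu.
Qed.

Lemma measurable_fun_sumr (I : Type) (s : seq I) (h : I -> T -> R) :
  (forall i, measurable_fun setT (h i)) -> measurable_fun setT (fun t => \sum_(i <- s) h i t).
Proof.
move=> mh; elim: s => [|i s IH].
  by under eq_fun do rewrite big_nil; exact: measurable_cst.
by under eq_fun do rewrite big_cons; exact: measurable_funD.
Qed.

Lemma measurable_fun_card (I : finType) (b : T -> pred I) :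
  (forall i, measurable_fun setT (fun t => b t i)) ->
  measurable_fun setT (fun t => #|[set i | b t i]%SET|).
Proof.
move=> mb.
have mbn i : measurable_fun setT (fun t => b t i : nat).
  rewrite (_ : (fun t => _) = (fun t => if b t i then 1%N else 0%N)).
    by apply: measurable_fun_ifT => //; exact: measurable_cst.
  by apply/funext => t; case: (b t i).
rewrite (_ : (fun t => _) = (fun t => \sum_(i <- index_enum I) b t i)%N); last first.
  by apply/funext => t; rewrite cardsE -sum1_card big_mkcond.
elim: (index_enum I) => [|i s IH].
  by under eq_fun do rewrite big_nil; exact: measurable_cst.
by under eq_fun do rewrite big_cons; exact: measurable_fun_addn.
Qed.

Variables (nu : forall n, 'rV[R]_n -> R).
Hypothesis mnu : forall n, measurable_fun setT (@nu n).

Lemma measurable_nb_within N n (u : T -> nat -> 'rV[R]_n) (r : T -> R) (i : 'I_N) :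
  (forall j : 'I_N, measurable_fun setT (fun t => u t j)) -> measurable_fun setT r ->
  measurable_fun setT (fun t => nb_within nu (u t) (r t) i).
Proof.
move=> mu mr; apply: measurable_fun_card => j.
apply: measurable_and; first exact: measurable_cst.
apply: measurable_fun_ler => //; apply: (measurableT_comp (@mnu n)).
exact: measurable_fun_rV_sub.
Qed.

(** Sorting is bypassed: the distance exceeds [r] exactly when fewer than [k] neighbors lie within
    [r], and that count is measurable. *)
Lemma measurable_knn_dist dx dy k N (x : T -> nat -> 'rV[R]_dx) (y : T -> nat -> 'rV[R]_dy)
    (i : 'I_N) : (0 < k < N)%N ->
  (forall j : 'I_N, measurable_fun setT (fun t => x t j)) ->
  (forall j : 'I_N, measurable_fun setT (fun t => y t j)) ->
  measurable_fun setT (fun t => knn_dist k (x t) (y t) nu i).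
Proof.
move=> kN mx my mT; apply: (measurability _ (RGenOInfty.measurableE R)) => //.
move=> _ [_ [r ->] <-]; rewrite setTI.
pose nb t := nb_within nu (fun j => row_mx (x t j) (y t j)) r i.
have mnb : measurable_fun setT (fun t => (nb t < k)%N).
  apply: measurable_fun_leq; last exact: measurable_cst.
  apply: (measurableT_comp (f := succn)) => //.
  apply: measurable_nb_within; last exact: measurable_cst.
  by move=> j; exact: measurable_fun_row_mx.
have -> : (fun t => knn_dist k (x t) (y t) nu i) @^-1` `]r, +oo[ =
    (fun t => (nb t < k)%N) @^-1` [set true].
  apply/seteqP; split=> t /=; rewrite in_itv/= andbT ltNge knn_dist_le// -ltnNge//.
by rewrite -[X in measurable X]setTI; exact: mnb.
Qed.

Lemma measurable_ksg_term dx dy k N phi K a (x : T -> nat -> 'rV[R]_dx)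
    (y : T -> nat -> 'rV[R]_dy) (i : 'I_N) : (0 < k < N)%N ->
  (forall j : 'I_N, measurable_fun setT (fun t => x t j)) ->
  (forall j : 'I_N, measurable_fun setT (fun t => y t j)) ->
  measurable_fun setT (fun t => ksg_term nu k phi K a (x t) (y t) i).
Proof.
move=> kN mx my; have mrho := measurable_knn_dist i kN mx my.
apply: measurable_fun_ifT; last exact: measurable_cst.
  by apply: measurable_fun_ler => //; exact: measurable_cst.
have mphi : measurable_fun setT (phi : nat -> R) by [].
apply: measurable_funB; [apply: measurable_funB; first exact: measurable_cst|];
  by apply: (measurableT_comp mphi); exact: measurable_nb_within.
Qed.

End measurability.

Lemma measurable_linfnorm (R : realType) n : measurable_fun setT (@linfnorm R n).
Proof.
rewrite (_ : @linfnorm R n = (fun v => \big[Num.max/0]_ij `|v ij.1 ij.2|)); last first.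
  by apply/funext => v; rewrite linfnormE.
elim: (index_enum _) => [|ij s IH].
  by under eq_fun do rewrite big_nil; exact: measurable_cst.
under eq_fun do rewrite big_cons; apply: measurable_maxr => //.
by rewrite (ord1 ij.1); apply: measurableT_comp => //; exact: measurable_coord.
Qed.

Lemma measurable_l2norm (R : realType) n : measurable_fun setT (@l2norm R n).
Proof.
rewrite (_ : @l2norm R n = (fun v => (\sum_i v ord0 i ^+ 2) `^ 2^-1)); last first.
  by apply/funext => v; rewrite powR12_sqrt// sumr_ge0// => i _; exact: sqr_ge0.
apply: (measurableT_comp (measurable_powR _)).
by apply: measurable_fun_sumr => i; apply: measurable_funX; exact: measurable_coord.
Qed.

(** * Variance rate *)

(** The constant 2 covers the terms of index 0 and 1. Each later term [1/m] is at most
    [ln m - ln (m - 1)], from [ln (1 - 1/m) <= - 1/m]. *)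
Lemma harmonic_sum_le (R : realType) n : harmonic_sum R n.+2 <= 2 + ln n.+1%:R.
Proof.
rewrite /harmonic_sum; elim: n => [|n IH].
  by rewrite big_ord_recr big_ord1/= /inv_max1/= ln1 invr1; lra.
rewrite big_ord_recr/=; apply: le_trans (lerD IH (lexx _)) _.
rewrite -addrA lerD2l /inv_max1 (maxn_idPr _)//.
have := @le_ln1Dx R (- n.+2%:R^-1).
have n2 : 0 < n.+2%:R :> R by rewrite ltr0n.
rewrite ltrN2 invf_lt1// ltr1n => /(_ isT).
rewrite (_ : 1 - n.+2%:R^-1 = n.+1%:R / n.+2%:R); last first.
  by rewrite -[n.+1%:R](addrK 1) natr1 mulrBl divff ?gt_eqF// mul1r.
rewrite ln_div ?posrE ?ltr0n// => H.
by rewrite -lerBrDl -opprB lerNr.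
Qed.

Lemma ln_step (R : realType) m : (0 < m)%N -> `|ln m.+1%:R - ln m%:R| <= m%:R^-1 :> R.
Proof.
move=> m0; have mR : 0 < m%:R :> R by rewrite ltr0n.
rewrite -ln_div ?posrE ?ltr0n// ger0_norm; last first.
  by rewrite ln_ge0// ler_pdivlMr// mul1r ler_nat.
have := @le_ln1Dx R (m%:R^-1); rewrite (_ : 1 + _ = m.+1%:R / m%:R).
  by apply; rewrite (@lt_trans _ _ 0)// invr_gt0.
by rewrite -natr1 mulrDl divff ?gt_eqF// mul1r addrC.
Qed.

(** For [phi m = psi(m + 1)] the increment is at most [1/(m+1)], hence at most [1/m]. The shift
    keeps the argument above 1, as [digammaS] demands. *)
Lemma digamma_step (R : realType) m : (0 < m)%N ->
  `|digamma m.+2%:R - digamma m.+1%:R| <= m%:R^-1 :> R.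
Proof.
move=> m0; apply: le_trans (digammaS _ _) _ => //.
by rewrite lef_pV2 ?posrE ?ltr0n// ler_nat.
Qed.

(** Only the first [N] points enter, so the infinite sequences may be replaced by the entries of an
    [N]-tuple, whatever [nth] returns beyond them. *)
Lemma eq_ksg_term (R : realType) nu dx dy k N phi (K a : R) (x x' : nat -> 'rV[R]_dx)
    (y y' : nat -> 'rV[R]_dy) (i : 'I_N) :
  (forall j : 'I_N, x j = x' j) -> (forall j : 'I_N, y j = y' j) ->
  ksg_term nu k phi K a x y i = ksg_term nu k phi K a x' y' i.
Proof.
move=> xx' yy'.
have nbE n (u u' : nat -> 'rV[R]_n) r : (forall j : 'I_N, u j = u' j) ->
    nb_within nu u r i = nb_within nu u' r i.
  by move=> uu'; apply: eq_card => j; rewrite !inE !uu'.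
have knnE : knn_dist k x y nu i = knn_dist k x' y' nu i.
  by congr (nth _ (sort _ _) _); apply: eq_map => j; rewrite !xx' !yy'.
by rewrite /ksg_term knnE (nbE _ x x')// (nbE _ y y').
Qed.

Section variance_rate.
Context (R : realType) (dx dy k : nat) (d : measure_display) (T : measurableType d)
  (P : probability T R) (X : nat -> T -> 'rV[R]_dx) (Y : nat -> T -> 'rV[R]_dy).
Hypothesis k_gt0 : (0 < k)%N.
Hypothesis mX : forall i, measurable_fun setT (X i).
Hypothesis mY : forall i, measurable_fun setT (Y i).
Let Z i w : 'rV[R]_(dx + dy) := row_mx (X i w) (Y i w).
Hypothesis indepZ : mutually_independent P Z.
Hypothesis idZ : forall i j A, measurable A -> P (Z i @^-1` A) = P (Z j @^-1` A).

Variable nu : forall n, 'rV[R]_n -> R.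
Hypothesis mnu : forall n, measurable_fun setT (@nu n).
Hypothesis nuN : forall n (v : 'rV[R]_n), nu (- v) = nu v.
Hypothesis nu_row_mxl : forall n p (u : 'rV[R]_n) (v : 'rV[R]_p), nu u <= nu (row_mx u v).
Hypothesis nu_row_mxr : forall n p (u : 'rV[R]_n) (v : 'rV[R]_p), nu v <= nu (row_mx u v).
Variables (C : nat -> finType) (col : forall n, 'rV[R]_n -> C n).
Hypothesis cone : forall n, cone_coloring (@nu n) (@col n).

Variables (phi : nat -> R) (K a : nat -> R) (K0 : R).
Hypothesis phi_step : forall m, (0 < m)%N -> `|phi m.+1 - phi m| <= m%:R^-1.
Hypothesis K_le : forall N, (0 < N)%N -> `|K N| <= K0 + ln N%:R.

Let V N := 'V_P[fun w => N%:R^-1 * \sum_(i < N) ksg_term nu k phi (K N) (a N) (X ^~ w) (Y ^~ w) i].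

Let change N : R := ksg_bound N phi (K N) *+ 2 +
  ((#|C dx| + #|C dy|)%:R * harmonic_sum R N +
   (#|C (dx + dy)%N| * k)%:R * (ksg_bound N phi (K N) *+ 2)) *+ 2.

Lemma ksg_variance_le N : (k < N)%N ->
  (V N <= (change N ^+ 2 / 2 / N%:R)%:E)%E.
Proof.
move=> kN; have kN' : (0 < k < N)%N by rewrite k_gt0.
have N0 : (N%:R : R) != 0 by rewrite pnatr_eq0; lia.
pose g (t : N.-tuple 'rV[R]_(dx + dy)) : R := N%:R^-1 * \sum_(i < N)
  ksg_term nu k phi (K N) (a N) (fun j => lsubmx (nth 0 t j)) (fun j => rsubmx (nth 0 t j)) i.
have -> : V N = 'V_P[fun w => g [tuple Z i w | i < N]].
  congr (variance _ _); apply/funext => w; congr (_ * _); apply: eq_bigr => i _.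
  by apply: eq_ksg_term => j; rewrite -tnth_nth tnth_mktuple /Z ?row_mxKl ?row_mxKr.
(* This is the bounded difference estimate with constant [change N / N], since the estimator is an
   average. *)
have -> : change N ^+ 2 / 2 / N%:R = N%:R * (N%:R^-1 * change N) ^+ 2 / 2 by field.
have mZ i : measurable_fun setT (Z i) by exact: measurable_fun_row_mx.
apply: (bounded_difference_variance mZ indepZ idZ (B := N%:R^-1 * \sum_(i < N) ksg_bound N phi (K N))).
- apply: measurable_funM; first exact: measurable_cst.
  apply: measurable_fun_sumr => i; apply: measurable_ksg_term => // j.
    apply: measurable_fun_lsubmx; under eq_fun do rewrite -tnth_nth.
    exact: measurable_tnth.
  apply: measurable_fun_rsubmx; under eq_fun do rewrite -tnth_nth.
  exact: measurable_tnth.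
- move=> t; rewrite /g normrM ger0_norm ?invr_ge0// ler_wpM2l ?invr_ge0//.
  rewrite (le_trans (ler_norm_sum _ _ _))// ler_sum// => i _.
  exact: ksg_term_le.
- move=> t t' l tt'; rewrite /g -mulrBr normrM ger0_norm ?invr_ge0// ler_wpM2l ?invr_ge0//.
  apply: (@sum_ksg_term_change _ nu nuN nu_row_mxl nu_row_mxr _ _ _ _ _ _ _ k_gt0 kN phi_step
    _ _ _ _ l _ _ _ _ _ _ (@cone _) (@cone _) (@cone _)) => j jl.
    by rewrite -!tnth_nth tt'.
  by rewrite -!tnth_nth tt'.
Qed.

Lemma change_le : exists2 D : R, 0 <= D &
  forall N, (3 <= N)%N -> 1 <= ln N%:R :> R -> 0 <= change N <= D * ln N%:R.
Proof.
pose F := `|phi 0| + `|phi 1|.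
(* [E] bounds [ksg_bound] in units of log N: [|K0| + 1] comes from [K_le], [F] from the first two
   values of [phi], and 3 from the harmonic sum. Constants are absorbed by [1 <= L]. *)
pose E := `|K0| + 1 + (F + 3) *+ 2.
pose A : R := (#|C dx| + #|C dy|)%:R; pose B : R := (#|C (dx + dy)%N| * k)%:R.
have F0 : 0 <= F by rewrite addr_ge0.
have A0 : 0 <= A by exact: ler0n.
have B0 : 0 <= B by exact: ler0n.
have E0 : 0 <= E by rewrite addr_ge0// ?mulrn_wge0// addr_ge0.
exists (E *+ 2 + (A * 3 + B * (E *+ 2)) *+ 2).
  by rewrite addr_ge0 ?mulrn_wge0// addr_ge0// mulr_ge0// mulrn_wge0.
move=> [|[|[|n]]]// _; set N := n.+3; set L := ln _ => L1.
have H0 : 0 <= harmonic_sum R N by apply: sumr_ge0 => j _; exact: inv_max1_ge0.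
have HL : harmonic_sum R N <= 3 * L.
  have lnle : ln n.+2%:R <= L by rewrite ler_ln ?posrE ?ltr0n// ler_nat.
  apply: le_trans (harmonic_sum_le R n.+1) _; lra.
have KL : `|K N| <= (`|K0| + 1) * L.
  apply: le_trans (K_le _) _ => //; rewrite mulrDl mul1r lerD2r.
  by rewrite (le_trans (ler_norm _))// ler_peMr.
have FL : F <= F * L by rewrite ler_peMr.
have M0 : 0 <= ksg_bound N phi (K N).
  by rewrite /ksg_bound addr_ge0// mulrn_wge0// addr_ge0.
have ML : ksg_bound N phi (K N) <= E * L.
  by rewrite /ksg_bound -/F /E; lra.
have AH : A * harmonic_sum R N <= A * (3 * L) by rewrite ler_wpM2l.
have BM : B * (ksg_bound N phi (K N) *+ 2) <= B * (E * L *+ 2).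
  by rewrite ler_wpM2l// lerMn2r.
rewrite /change -/A -/B; apply/andP; split.
  by rewrite addr_ge0 ?mulrn_wge0// addr_ge0// mulr_ge0// mulrn_wge0.
by lra.
Qed.

Lemma ksg_variance_rate delta : 0 < delta -> ebigO V (variance_rate k delta).
Proof.
move=> delta0.
have [D D0 changeD] := change_le.
have big : \forall N \near \oo, [/\ (3 <= N)%N, (k < N)%N & 1 <= ln (ln N%:R) :> R].
  near=> N; split.
  - by near: N; exact: nbhs_infty_ge.
  - by near: N; exact: nbhs_infty_gt.
  - have eN : expR (expR 1) <= N%:R :> R by near: N; exact: nbhs_infty_ger.
    have eL : expR 1 <= ln N%:R :> R.
      by rewrite -(expRK (expR 1)) ler_ln ?posrE ?expR_gt0// (lt_le_trans (expR_gt0 _) eN).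
    by rewrite -[leLHS]expRK ler_ln ?posrE ?expR_gt0// (lt_le_trans (expR_gt0 _) eL).
have VD : \forall N \near \oo, (V N <= (D ^+ 2 / 2 * variance_rate k delta N)%:E)%E /\
    0 <= variance_rate k delta N.
  near=> N.
  have [N3 kN LL1] : [/\ (3 <= N)%N, (k < N)%N & 1 <= ln (ln N%:R) :> R] by near: N.
  set L := ln N%:R in LL1 *.
  have L1 : 1 <= L.
    by rewrite leNgt; apply/negP => /ltW/ln_le0 /(le_trans LL1); rewrite ler10.
  have /andP[c0 cD] := changeD N N3 L1.
  have NV0 : 0 <= N%:R^-1 :> R by rewrite invr_ge0.
  (* The exponent [(2k + 2)(1 + delta)] is at least 2 and the squared iterated logarithm is at least
     1, so [L^2 / N] lies below the claimed rate. *)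
  have rate : L ^+ 2 / N%:R <= variance_rate k delta N.
    rewrite /variance_rate -/L ler_wpM2r//.
    apply: (@le_trans _ _ (L `^ ((2 * k + 2)%:R * (1 + delta)))).
      rewrite -powR_mulrn ?(le_trans ler01)// ler_powR//.
      have : (2 : R) <= (2 * k + 2)%:R by rewrite ler_nat leq_addl.
      by move=> h; rewrite (le_trans h)// ler_peMr// lerDl ltW.
    by rewrite ler_peMl ?powR_ge0// exprn_ege1.
  split.
    apply: (le_trans (ksg_variance_le kN)); rewrite lee_fin.
    apply: (@le_trans _ _ (D ^+ 2 / 2 * (L ^+ 2 / N%:R))); last first.
      by rewrite ler_wpM2l// mulr_ge0 ?sqr_ge0.
    rewrite mulrA ler_wpM2r// [leRHS]mulrAC ler_wpM2r// -exprMn.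
    by rewrite ler_pXn2r ?nnegrE// mulr_ge0// (le_trans ler01).
  by apply: le_trans rate; rewrite mulr_ge0// sqr_ge0.
have V0 N : (0 <= V N)%E by exact: variance_ge0.
split.
  near=> N; rewrite ge0_fin_numE//.
  have /(_ _)[|+ _] := near VD N => //.
  by move=> /le_lt_trans; apply; rewrite ltry.
(* Adding 1 makes the constant strictly positive even when [D = 0]. *)
apply/eqO_exP; exists (D ^+ 2 / 2 + 1); first by rewrite ltr_wpDl// mulr_ge0 ?sqr_ge0.
near=> N.
have [VN r0] : (V N <= (D ^+ 2 / 2 * variance_rate k delta N)%:E)%E /\
    0 <= variance_rate k delta N by near: N.
rewrite !ger0_norm ?fine_ge0//.
have Vfin : V N \is a fin_num by rewrite ge0_fin_numE// (le_lt_trans VN)// ltry.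
rewrite -lee_fin fineK// (le_trans VN)// lee_fin ler_wpM2r//.
by rewrite lerDl.
Unshelve. all: by end_near. Qed.

End variance_rate.

Theorem theorem8 (R : realType) (dx dy k : nat) (delta : R)
    (f : 'rV[R]_(dx + dy) -> R)
    (d : measure_display) (T : measurableType d) (P : probability T R)
    (X : nat -> {RV P >-> 'rV[R]_dx}) (Y : nat -> {RV P >-> 'rV[R]_dy}) :
  (1 <= dx)%N -> (1 <= dy)%N -> (1 <= k)%N -> 0 < delta ->
  assumptionC f ->
  (forall i, has_density P (leb R (dx + dy))
               (fun w => row_mx (X i w) (Y i w)) f) ->
  mutually_independent P (fun i w => row_mx (X i w) (Y i w)) ->
  ebigO (fun N => 'V_P[fun w => tKSG k N delta (X ^~ w) (Y ^~ w)])
        (variance_rate k delta) /\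
  ebigO (fun N => 'V_P[fun w => tBI_KSG k N delta (X ^~ w) (Y ^~ w)])
        (variance_rate k delta).
Proof.
move=> _ _ k0 delta0 _ density indep.
have mX i : measurable_fun setT (X i) by exact: measurable_funPT.
have mY i : measurable_fun setT (Y i) by exact: measurable_funPT.
(* A common density makes the points identically distributed. *)
have same_law i j A : measurable A ->
    P ((fun w => row_mx (X i w) (Y i w)) @^-1` A) =
    P ((fun w => row_mx (X j w) (Y j w)) @^-1` A).
  by move=> mA; case: (density i) => _ _ ->//; case: (density j) => _ _ ->.
have K_le c N : (0 < N)%N -> `|c + ln N%:R| <= `|c| + ln N%:R :> R.
  move=> N0; rewrite (le_trans (ler_normD _ _))// lerD2l ger0_norm//.
  by rewrite ln_ge0// ler1n.
split.
- exact: (ksg_variance_rate k0 mX mY indep same_law (@measurable_linfnorm R)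
    (@linfnormN R) (@linfnorm_row_mxl R) (@linfnorm_row_mxr R)
    (@linf_cone_coloring R) (phi := fun n => digamma n.+1%:R)
    (K := fun N => digamma k%:R + ln N%:R) (fun N => @trunc_radius R dx dy N delta)
    (@digamma_step R) (K_le _) delta0).
(* Here [phi] is the logarithm, and the ratio of ball volumes joins the constant part of [K]. *)
- apply: (ksg_variance_rate k0 mX mY indep same_law (@measurable_l2norm R)
    (@l2normN R) (@l2norm_row_mxl R) (@l2norm_row_mxr R)
    (@l2_cone_coloring R) (phi := fun n => ln n%:R)
    (K := fun N => digamma k%:R + ln N%:R
      + ln (ball_volume2 dx * ball_volume2 dy / ball_volume2 (dx + dy)))
    (fun N => @trunc_radius R dx dy N delta)
    (@ln_step R) _ delta0) => N N0.
  rewrite addrAC; exact: K_le.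
Qed.
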